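(* Let $H$ be an infinite dimensional complex Hilbert space and let $\mathcal{V} \subseteq \mathcal{B}(H)$ be an operator system. Then $\mathcal{V}$ has either an infinite quantum clique, an infinite quantum anticlique or an infinite quantum obstruction (i.e. at least one of these three exists).
   Context: $\mathcal{B}(H)$ is the space of bounded linear operators on $H$. An operator system is a (not necessarily closed) linear subspace $\mathcal{V} \subseteq \mathcal{B}(H)$ containing the identity $I_H$ and closed under adjoints. Projections are orthogonal projections. The weak topology on $\mathcal{B}(H)$ is the weak operator topology: $T_i \to T$ iff $\langle T_i x, y\rangle \to \langle Tx,y\rangle$ for all $x,y\in H$. For a projection $P$, the compression of $\mathcal{V}$ is $P\mathcal{V}P = \{PAP : A \in \mathcal{V}\}$. An infinite quantum clique of $\mathcal{V}$ is an infinite rank projection $P \in \mathcal{B}(H)$ such that $P\mathcal{V}P$ is weakly dense in $P\mathcal{B}(H)P$. An infinite quantum anticlique of $\mathcal{V}$ is an infinite rank projection $P \in \mathcal{B}(H)$ such that $P\mathcal{V}P = \mathbb{C}P$. An infinite quantum obstruction of $\mathcal{V}$ is an infinite rank projection $P \in \mathcal{B}(H)$ such that $P\mathcal{V}P$ is finite dimensional, every operator in $P\mathcal{V}P$ can be written as the sum of a scalar multiple of $P$ and a compact operator, and $P\mathcal{V}P$ contains a self-adjoint compact operator with range dense in $PH$. *)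

(* Defs.v *)
From HB Require Import structures.
From mathcomp Require Import all_boot all_order all_algebra.
From mathcomp Require Import sesquilinear complex.
From mathcomp Require Import boolp classical_sets functions reals.
From mathcomp Require Import topology normedtype.

Set Implicit Arguments.
Unset Strict Implicit.
Unset Printing Implicit Defensive.

Import Order.TTheory GRing.Theory Num.Theory.
Import numFieldNormedType.Exports.

Local Open Scope classical_set_scope.
Local Open Scope ring_scope.
Local Open Scope complex_scope.

(* The library's dot products are linear in the first argument and
   conjugate-linear in the second. *)
HB.mixin Record CompleteNormedModule_isHilbert (R : realType) H
    of CompleteNormedModule R[i] H := {
  hdot : {dot H for @Num.conj R[i]} ;
  sqr_norm_hdot : forall x : H, `|x| ^+ 2 = hdot x x
}.

#[short(type="hilbertType")]
HB.structure Definition Hilbert (R : realType) :=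
  {H of CompleteNormedModule R[i] H & CompleteNormedModule_isHilbert R H}.

Notation "''[' x , y ]" := (hdot x%R y%R) (format "''[' x ,  y ]") : ring_scope.

Section LinearAlgebra.
Context {K : fieldType} {E : lmodType K}.

Definition lin_span (s : seq E) : set E :=
  [set \sum_(i < size s) c i *: s`_i | c in [set: 'I_(size s) -> K]].

Definition finite_dim (W : set E) : Prop := exists s : seq E, W = lin_span s.

End LinearAlgebra.

(* Operators are functions H -> H, with the library's pointwise module
   structure; composition is \o and the identity is idfun. *)
Section Operators.
Context {R : realType} {H : hilbertType R}.
Implicit Types (T S P : H -> H) (V : set (H -> H)).

Definition bounded_op : set (H -> H) :=
  [set T | linear T /\ exists M : R[i], forall x, `|T x| <= M * `|x|].

Definition adjoint_of T S : Prop := forall x y, '[T x, y] = '[x, S y].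

Definition self_adjoint T : Prop := adjoint_of T T.

Definition projection P : Prop :=
  [/\ bounded_op P, P \o P = P & self_adjoint P].

Definition compact_op T : Prop :=
  bounded_op T /\ precompact (T @` [set x | `|x| <= 1]).

Definition infinite_rank T : Prop := ~ finite_dim (range T).

Definition operator_system V : Prop :=
  [/\ V `<=` bounded_op,
      V idfun,
      forall (a : R[i]) T S, V T -> V S -> V (a *: T + S) &
      forall T, V T -> exists2 S, V S & adjoint_of T S].

Definition compression P V : set (H -> H) := [set P \o T \o P | T in V].

End Operators.

(* H -> H with the initial topology for T |-> ((x, y) |-> <T x, y>), where
   the target carries pointwise convergence.  On bounded_op it induces the
   weak operator topology; see wot_cvgP. *)
Definition matrix_coef (R : realType) (H : hilbertType R) (T : H -> H) :
  {ptws H * H -> R[i]^o} := fun p => '[T p.1, p.2].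

Definition wot (R : realType) (H : hilbertType R) : topologicalType :=
  initial_topology (@matrix_coef R H).

Lemma wot_cvgP (R : realType) (H : hilbertType R) (I : Type)
    (F : set_system I) (T : I -> wot H) (S : wot H) : Filter F ->
  T @ F --> S <->
  forall x y : H, '[T i x, y] @[i --> F] --> ('[S x, y] : R[i]^o).
Proof.
move=> FF.
have cvgE : @matrix_coef R H \o T @ F --> matrix_coef S <->
    forall x y : H, '[T i x, y] @[i --> F] --> ('[S x, y] : R[i]^o).
  split=> [/pointwise_cvgP cTS x y|cTS]; first exact: (cTS (x, y)).
  by apply/pointwise_cvgP => -[x y]; exact: cTS.
rewrite -cvgE; split=> [cTS|cTS A].
  by apply: (cvg_comp _ _ cTS); exact: initial_continuous.
rewrite nbhsE => -[_ [[C oC <-] CS] CA].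
have FC : F ((@matrix_coef R H \o T) @^-1` C).
  by apply: cTS; exact: open_nbhs_nbhs.
exact: filterS CA FC.
Qed.

Definition weakly_dense (R : realType) (H : hilbertType R)
  (A B : set (H -> H)) : Prop := A `<=` B /\ B `<=` closure (A : set (wot H)).

Section Obstructions.
Context {R : realType} {H : hilbertType R}.
Implicit Types (P : H -> H) (V : set (H -> H)).

Definition infinite_quantum_clique V P : Prop :=
  [/\ projection P, infinite_rank P &
      weakly_dense (compression P V) (compression P bounded_op)].

Definition infinite_quantum_anticlique V P : Prop :=
  [/\ projection P, infinite_rank P &
      compression P V = [set a *: P | a in [set: R[i]]]].

Definition infinite_quantum_obstruction V P : Prop :=
  [/\ projection P, infinite_rank P, finite_dim (compression P V),
      forall A, compression P V A ->
        exists (a : R[i]) K, compact_op K /\ A = a *: P + K &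
      exists A, [/\ compression P V A, self_adjoint A, compact_op A &
                    range P `<=` closure (range A)]].

End Obstructions.

(* Main.v *)
(* For a self-adjoint [A] in [V] and an infinite dimensional subspace [X], a
   smaller infinite dimensional [X'] makes the compression of [A] to [X'] equal
   to a scalar [l] plus a compact operator that is diagonal in an orthonormal
   sequence spanning [X'].

   If some compression of [V] to an infinite dimensional subspace is spanned by
   the identity and [n] operators, take [n] minimal.  After thinning, these
   operators are compact and diagonal.  For [n = 0] this is an anticlique; for
   [n > 0], minimality forces the first of them to have only finitely many zero
   diagonal entries, and cutting those off gives an obstruction.

   Otherwise a compression of [V] always contains a form with essential value
   [0] vanishing on any prescribed finite set.  This builds an orthonormal
   sequence [f] and [A n] in [V] diagonal in [f], with [A n] close to the rank
   one projection on [f n].  A finite rank functional annihilating all [A n] has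
   zero diagonal in [f].  In a closed subspace placed suitably skew with respect
   to [f] this forces the functional to be zero by polarization, so the
   compression of [V] to that subspace is weakly dense. *)
Require Import Defs.
From HB Require Import structures.
From mathcomp Require Import all_boot all_order all_algebra.
From mathcomp Require Import sesquilinear complex.
From mathcomp Require Import boolp classical_sets functions reals.
From mathcomp Require Import topology normedtype.
From mathcomp Require Import ring lra.

Set Implicit Arguments.
Unset Strict Implicit.
Unset Printing Implicit Defensive.

Import Order.TTheory GRing.Theory Num.Theory.
Import numFieldNormedType.Exports.

Local Open Scope classical_set_scope.
Local Open Scope ring_scope.
Local Notation "x %:C" := (real_complex _ x) : ring_scope.

(** * Inner products and quadratic forms *)

(** The argument is run on algebraic subspaces and on quadratic forms of self-adjoint members of
    [V], a real vector space, so that conditions on forms can be counted with real coefficients;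
    closed subspaces enter only when a projection is produced. If no compression is finite
    dimensional, arbitrarily many independent forms exist on each infinite dimensional subspace, and
    taking one unknown more than there are conditions kills finitely many matrix entries together
    with an essential value. The obstacle is that [f n] must be orthogonal to [A n (f k)] for
    [k < n] although [A n] and [f n] are found together: counting alone gives a form vanishing on
    the past, with no control of its mixed entries. This is what [null_form_orth] repairs. Essential
    value [0] makes [A n] small on later vectors once its value at [f n] is scaled to [1]. Weak
    neighbourhoods test finitely many matrix coefficients, so density reduces to interpolating
    these, and only functionals [T |-> sum c_i <T u_i, w_i>] must be shown to vanish. *)

Section InnerProduct.
Context {R : realType} {H : hilbertType R}.
Local Notation C := R[i].
Implicit Types (x y z : H) (a b : C).

Lemma ipC x y : '[x, y] = ('[y, x])^*.
Proof. by rewrite (hermC hdot) expr0 mul1r. Qed.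
Lemma ipDl x y z : '[x + y, z] = '[x, z] + '[y, z].
Proof. exact: linearDl. Qed.
Lemma ipZl a x y : '[a *: x, y] = a * '[x, y].
Proof. exact: linearZl_LR. Qed.
Lemma ipDr x y z : '[x, y + z] = '[x, y] + '[x, z].
Proof. exact: linearDr. Qed.
Lemma ipZr a x y : '[x, a *: y] = a^* * '[x, y].
Proof. by rewrite linearZr_LR. Qed.
Lemma ip0l y : '[0, y] = 0.
Proof. exact: linear0l. Qed.
Lemma ip0r y : '[y, 0] = 0.
Proof. exact: linear0r. Qed.
Lemma ipBl x y z : '[x - y, z] = '[x, z] - '[y, z].
Proof. exact: linearBl. Qed.
Lemma ipBr x y z : '[x, y - z] = '[x, y] - '[x, z].
Proof. exact: linearBr. Qed.
Lemma ip_suml I (r : seq I) (P : pred I) (F : I -> H) y :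
  '[\sum_(i <- r | P i) F i, y] = \sum_(i <- r | P i) '[F i, y].
Proof. exact: linear_sumlz. Qed.
Lemma ip_sumr I (r : seq I) (P : pred I) (F : I -> H) y :
  '[y, \sum_(i <- r | P i) F i] = \sum_(i <- r | P i) '[y, F i].
Proof. exact: linear_sumr. Qed.

Lemma ip_ge0 x : 0 <= '[x, x].
Proof. by rewrite -sqr_norm_hdot exprn_ge0. Qed.
Lemma ip_eq0 x : ('[x, x] == 0) = (x == 0).
Proof. by rewrite -sqr_norm_hdot sqrf_eq0 normr_eq0. Qed.
Lemma ip_orthC x y : '[x, y] = 0 -> '[y, x] = 0.
Proof. by move=> h; rewrite ipC h rmorph0. Qed.

Lemma cauchy_schwarz x y : `|'[x, y]| <= `|x| * `|y|.
Proof.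
have [->|y0] := eqVneq y 0; first by rewrite ip0r !normr0 mulr0.
have yy : 0 < '[y, y] by rewrite lt_def ip_ge0 ip_eq0 y0.
rewrite -(@ler_pXn2r _ 2) // ?nnegrE ?mulr_ge0// exprMn !sqr_norm_hdot.
have := ip_ge0 (x - ('[x, y] / '[y, y]) *: y).
rewrite !ipBl !ipBr !ipZl !ipZr [in '[y, x]]ipC.
set c := '[x, y]; set d := '[y, y]; have dr : d^* = d by rewrite -ipC.
rewrite fmorph_div /= dr.
have -> : '[x, x] - c^* / d * c - (c / d * c^* - c / d * (c^* / d * d))
  = '[x, x] - (c * c^*) / d by field; rewrite gt_eqF.
by rewrite subr_ge0 ler_pdivrMr// -normCK.
Qed.

Definition sqn x : R := complex.Re '[x, x].
Lemma sqnE x : '[x, x] = (sqn x)%:C.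
Proof. by rewrite /sqn RRe_real// ger0_real// ip_ge0. Qed.
Lemma sqn_ge0 x : 0 <= sqn x.
Proof. by rewrite -ler0c -sqnE ip_ge0. Qed.

End InnerProduct.
Section Quadratic.
Context {R : realType} {H : hilbertType R}.
Local Notation C := R[i].
Implicit Types (x y z : H) (a b : C) (A B : H -> H).

(** The real part puts the values in the ordered field [R], where suprema can be taken; for
    self-adjoint [A] nothing is lost, by [qformE]. *)
Definition qform A x : R := complex.Re '[A x, x].

Lemma conjR (t : R) : (t%:C : C)^* = t%:C.
Proof. exact: conjc_real. Qed.

Lemma self_adjointC A x y : self_adjoint A -> '[A x, y] = ('[A y, x])^*.
Proof. by move=> sA; rewrite sA -ipC. Qed.

Lemma qformE A x : self_adjoint A -> '[A x, x] = (qform A x)%:C.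
Proof.
move=> sA; rewrite /qform RRe_real//.
by apply/CrealP; rewrite -self_adjointC.
Qed.

Lemma qform_id x : qform idfun x = sqn x. Proof. by []. Qed.

Lemma ReD (a b : C) : complex.Re (a + b) = complex.Re a + complex.Re b.
Proof. by case: a b => [? ?] []. Qed.
Lemma ReRM (t : R) (a : C) : complex.Re (t%:C * a) = t * complex.Re a.
Proof. by case: a => [? ?] /=; rewrite mul0r subr0. Qed.
Lemma ImRM (t : R) (a : C) : complex.Im (t%:C * a) = t * complex.Im a.
Proof. by case: a => [? ?] /=; rewrite mul0r addr0. Qed.
Lemma ReN (a : C) : complex.Re (- a) = - complex.Re a.
Proof. by case: a. Qed.
Lemma Re_sum I (r : seq I) (P : pred I) (F : I -> C) :
  complex.Re (\sum_(i <- r | P i) F i) = \sum_(i <- r | P i) complex.Re (F i).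
Proof. by elim/big_rec2: _ => [//|i x y _ <-]; rewrite ReD. Qed.
Lemma Im_sum I (r : seq I) (P : pred I) (F : I -> C) :
  complex.Im (\sum_(i <- r | P i) F i) = \sum_(i <- r | P i) complex.Im (F i).
Proof. by elim/big_rec2: _ => [//|i x y _ <-]; case: (F i) y => [? ?] []. Qed.
Lemma normC_sqr (a : C) : `|a| ^+ 2 = (complex.Re a ^+ 2 + complex.Im a ^+ 2)%:C.
Proof. by rewrite add_Re2_Im2. Qed.

Lemma linD A x y : linear A -> A (x + y) = A x + A y.
Proof. by move=> lA; rewrite -[x]scale1r lA !scale1r. Qed.
Lemma lin0 A : linear A -> A 0 = 0.
Proof.
move=> lA; have := linD 0 0 lA; rewrite addr0 => /eqP.
by rewrite -subr_eq subrr eq_sym => /eqP.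
Qed.
Lemma linZ A a x : linear A -> A (a *: x) = a *: A x.
Proof. by move=> lA; rewrite -[a *: x]addr0 lA lin0// !addr0. Qed.
Lemma linN A x : linear A -> A (- x) = - A x.
Proof. by move=> lA; rewrite -scaleN1r linZ// scaleN1r. Qed.
Lemma linB A x y : linear A -> A (x - y) = A x - A y.
Proof. by move=> lA; rewrite linD// linN. Qed.
Lemma lin_sum A I (r : seq I) (P : pred I) (F : I -> H) : linear A ->
  A (\sum_(i <- r | P i) F i) = \sum_(i <- r | P i) A (F i).
Proof.
move=> lA; elim/big_rec2: _ => [|i x y _ <-]; first exact: lin0.
exact: linD.
Qed.

Definition subspace (X : set H) : Prop :=
  X 0 /\ forall a x y, X x -> X y -> X (a *: x + y).

Lemma subspace_sum X I (r : seq I) (P : pred I) (F : I -> H) : subspace X ->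
  (forall i, P i -> X (F i)) -> X (\sum_(i <- r | P i) F i).
Proof.
move=> [X0 XD] XF; elim/big_rec: _ => [//|i x Pi Xx].
by rewrite -[F i]scale1r; apply: XD => //; exact: XF.
Qed.

Lemma subspaceZ X a x : subspace X -> X x -> X (a *: x).
Proof. by move=> [X0 XD] Xx; rewrite -[_ *: _]addr0; exact: XD. Qed.

Lemma subspaceD X x y : subspace X -> X x -> X y -> X (x + y).
Proof. by move=> [X0 XD] Xx Xy; rewrite -[x]scale1r; exact: XD. Qed.

Lemma sqnZ a x : sqn (a *: x) = (complex.Re a ^+ 2 + complex.Im a ^+ 2) * sqn x.
Proof.
apply: complexI; rewrite -sqnE ipZl ipZr mulrA -normCK normC_sqr sqnE.
by rewrite -rmorphM.
Qed.

Lemma qformZ A a x : linear A ->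
  qform A (a *: x) = (complex.Re a ^+ 2 + complex.Im a ^+ 2) * qform A x.
Proof.
move=> lA; rewrite /qform linZ// ipZl ipZr mulrA -normCK normC_sqr.
by rewrite ReRM.
Qed.

Lemma unit_normalize x : x != 0 -> exists a : C, '[a *: x, a *: x] = 1.
Proof.
move=> x0; exists (`|x|^-1); rewrite ipZl ipZr -sqr_norm_hdot.
rewrite geC0_conj ?invr_ge0//; field; by rewrite normr_eq0.
Qed.

Lemma sqn_sum n (c : nat -> C) (g : nat -> H) :
  (forall i j, '[g i, g j] = (i == j)%:R) ->
  sqn (\sum_(k < n) c k *: g k) = \sum_(k < n) sqn (c k *: g k).
Proof.
move=> og; rewrite /sqn -Re_sum; congr complex.Re.
rewrite ip_suml; apply: eq_bigr => i _.
rewrite ip_sumr (bigD1 i)//= big1 ?addr0// => j ji.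
by rewrite ipZl ipZr og eq_sym (negbTE (ji : (nat_of_ord j != i))) !mulr0.
Qed.

End Quadratic.

(** Dependent choice in which a term may depend on all earlier ones. An extension is demanded only
    for histories whose entries satisfy [Q], since invariants of the past are needed to continue;
    other histories receive the default [t0]. *)
Lemma choose_hist {T : Type} (t0 : T) (Q : seq T -> T -> Prop) :
  (forall h, (forall i, (i < size h)%N -> Q (take i h) (nth t0 h i)) ->
     exists t, Q h t) ->
  exists g : nat -> T, forall n, Q (mkseq g n) (g n).
Proof.
move=> ex.
pose good h := forall i, (i < size h)%N -> Q (take i h) (nth t0 h i).
have ex' h : exists t, good h -> Q h t.
  have [gh|ngh] := pselect (good h); last by exists t0.
  by have [t Qt] := ex h gh; exists t.
have [next nextP] := choice ex'.
pose hist := fix hist n := if n is m.+1 then rcons (hist m) (next (hist m)) else [::].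
pose g n := next (hist n).
have histE n : hist n = mkseq g n.
  by elim: n => [//|n IH]; rewrite mkseqS -IH.
have takeE i n : (i <= n)%N -> take i (mkseq g n) = mkseq g i.
  by move=> le_in; rewrite -map_take take_iota (minn_idPl le_in).
exists g; elim/ltn_ind => n IH; rewrite -histE; apply: nextP.
rewrite /good histE size_mkseq => i lt_in.
by rewrite takeE ?(ltnW lt_in)// nth_mkseq//; exact: IH.
Qed.

(** * Infinite dimensional subspaces *)

Section LinearAlgebra.
Variable F : fieldType.

Lemma underdetermined_system N (L : seq (nat -> F)) : (size L < N)%N ->
  exists2 t : nat -> F, exists2 i, (i < N)%N & t i != 0 &
    forall j, (j < size L)%N -> \sum_(i < N) t i * nth (fun=> 0) L j i = 0.
Proof.
move=> ltLN; pose M : 'M[F]_(N, size L) := \matrix_(i, j) nth (fun=> 0) L j i.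
have : kermx M != 0.
  rewrite kermx_eq0 /row_free; apply: contraTneq ltLN => rM.
  by rewrite -leqNgt -{1}rM rank_leq_col.
move=> /rowV0Pn[v /sub_kermxP vM v0].
have [i vi0] : exists i, v 0 i != 0.
  apply/existsP; apply: contra_neqT v0; rewrite negb_exists => /forallP v0.
  by apply/rowP => i; rewrite mxE; apply/eqP; have := v0 i; rewrite negbK.
pose t k : F := oapp (v 0) 0 (insub k : option 'I_N).
have tE (k : 'I_N) : t k = v 0 k by rewrite /t valK.
exists t; first by exists i => //; rewrite tE.
move=> j ltj; have /rowP/(_ (Ordinal ltj)) := vM; rewrite !mxE => vMj; rewrite -[RHS]vMj.
by apply: eq_bigr => k _; rewrite tE mxE.
Qed.

(** Among the matrices with row space inside [W], take one of maximal rank: adding a vector of [W]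
    cannot raise the rank, so that vector was already in the row space. *)
Lemma subspace_rowspace n (W : set 'rV[F]_n) : W 0 ->
  (forall a u v, W u -> W v -> W (a *: u + v)) ->
  exists M : 'M[F]_n, forall v, W v <-> (v <= M)%MS.
Proof.
move=> W0 WD.
pose inW (M : 'M[F]_n) := forall v, (v <= M)%MS -> W v.
pose P k := `[< exists2 M, inW M & \rank M = k >].
have exP : exists k, P k.
  exists 0%N; apply/asboolP; exists 0; last exact: mxrank0.
  by move=> v; rewrite submx0 => /eqP ->.
have ubP k : P k -> (k <= n)%N.
  by move=> /asboolP[M _ <-]; exact: rank_leq_row.
case: (ex_maxnP exP ubP) => r /asboolP[M MW rM] rmax.
exists M => v; split=> [Wv|]; last exact: MW.
have inMv : inW (M + v)%MS.
  move=> w /sub_addsmxP[[u1 u2]] /= ->; rewrite addrC.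
  have -> : u2 *m v = u2 0 0 *: v.
    by rewrite [u2]mx11_scalar mul_scalar_mx mxE.
  by apply: WD => //; apply: MW; exact: submxMl.
have := rmax _ (asboolT (ex_intro2 _ _ _ inMv erefl)); rewrite -rM => le_r.
have := mxrank_leqif_sup (addsmxSl M v); case=> _ /esym.
rewrite eqn_leq le_r mxrankS ?addsmxSl//= => MvM.
by apply: submx_trans MvM; exact: addsmxSr.
Qed.

(** Finite dimensional Hahn-Banach: the columns of the cokernel matrix are the test functionals. *)
Lemma subspace_separation n (W : set 'rV[F]_n) s : W 0 ->
  (forall a u v, W u -> W v -> W (a *: u + v)) ->
  (forall c : 'cV[F]_n, (forall w, W w -> w *m c = 0) -> s *m c = 0) -> W s.
Proof.
move=> W0 WD h; have [M WM] := subspace_rowspace W0 WD; apply/WM.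
rewrite submxE; apply/eqP/rowP => j; rewrite [RHS]mxE.
have -> : (s *m cokermx M) 0 j = (s *m col j (cokermx M)) 0 0.
  by rewrite colE mulmxA -colE [RHS]mxE.
rewrite h ?mxE// => w /WM; rewrite submxE => /eqP wM.
by rewrite colE mulmxA wM mul0mx.
Qed.

End LinearAlgebra.

Lemma lin_spanP (K : fieldType) (E : lmodType K) (s : seq E) x :
  lin_span s x <-> exists c : nat -> K, x = \sum_(i < size s) c i *: s`_i.
Proof.
split=> [[c _ <-]|[c ->]]; last by exists (fun i => c i).
exists (fun i => oapp c 0 (insub i)).
by apply: eq_bigr => i _; rewrite valK.
Qed.

Section Big.
Context {R : realType} {H : hilbertType R}.
Local Notation C := R[i].
Implicit Types (x y z : H) (a b : C) (A B : H -> H) (X : set H) (Z : seq H).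

(* For a subspace, this is equivalent to infinite dimensionality. *)
Definition big X : Prop := subspace X /\
  forall Z, exists2 x, X x & '[x, x] = 1 /\ forall z, z \in Z -> '[x, z] = 0.

Definition perp X Z : set H := [set x | X x /\ forall z, z \in Z -> '[x, z] = 0].

Lemma sub_perp X Z : perp X Z `<=` X. Proof. by move=> x []. Qed.

Lemma big_perp X Z : big X -> big (perp X Z).
Proof.
move=> [[X0 XD] bX]; split.
  split; first by split=> // z _; rewrite ip0l.
  move=> a x y [Xx xZ] [Xy yZ]; split; first exact: XD.
  by move=> z zZ; rewrite ipDl ipZl xZ// yZ// mulr0 addr0.
move=> Z'; have [x Xx [nx xZ]] := bX (Z ++ Z').
exists x; last by split=> // z zZ; apply: xZ; rewrite mem_cat zZ orbT.
by split=> // z zZ; apply: xZ; rewrite mem_cat zZ.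
Qed.

(** If no unit vector were orthogonal to [Z], the inner products with [Z] would embed [H] into a
    finite dimensional row space, and preimages of spanning rows would span [H]. *)
Lemma big_setT : ~ finite_dim [set: H] -> big [set: H].
Proof.
move=> ninf; split; first by split.
move=> Z; apply: contrapT => nx; apply: ninf.
have sep x : (forall z, z \in Z -> '[x, z] = 0) -> x = 0.
  move=> xZ; apply/eqP; apply: contrapT => /negP x0; apply: nx.
  have [a na] := unit_normalize x0; exists (a *: x) => //; split=> // z zZ.
  by rewrite ipZl xZ// mulr0.
pose n := size Z; pose L x : 'rV[C]_n := \row_i '[x, Z`_i].
have LD a x y : L (a *: x + y) = a *: L x + L y.
  by apply/rowP => i; rewrite !mxE ipDl ipZl.
have [||M LM] := @subspace_rowspace _ n (range L).
- by exists 0 => //; apply/rowP => i; rewrite !mxE ip0l.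
- by move=> a _ _ [x _ <-] [y _ <-]; exists (a *: x + y).
have /choice[s sM] : forall i, exists x, L x = row i M.
  by move=> i; have /LM[x _ Lx] := row_sub i M; exists x.
pose f k := oapp s 0 (insub k : option 'I_n).
exists (mkseq f n); rewrite predeqE => x; split=> // _; apply/lin_spanP.
have /LM/submxP[u Lxu] : range L (L x) by exists x.
exists (fun k => oapp (u 0) 0 (insub k : option 'I_n)).
rewrite size_mkseq; apply/eqP; rewrite -subr_eq0; apply/eqP.
apply: sep => z zZ; have lti : (index z Z < n)%N by rewrite index_mem.
have /rowP/(_ (Ordinal lti)) := Lxu; rewrite !mxE /= nth_index// ipBl => ->.
apply/eqP; rewrite subr_eq0; apply/eqP; rewrite ip_suml.
apply: eq_bigr => i _; rewrite nth_mkseq// valK ipZl /f valK /=.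
by have /rowP/(_ (Ordinal lti)) := sM i; rewrite !mxE /= nth_index// => ->.
Qed.
End Big.

(** * Essential values and thinning *)

Section Thinning.
Context {R : realType} {H : hilbertType R}.
Local Notation C := R[i].
Implicit Types (x y z : H) (a b : C) (A B : H -> H) (X : set H) (Z : seq H).
Implicit Types (g : nat -> H) (l e : R).

Definition orthonormal_seq g := forall i j, '[g i, g j] = (i == j)%:R.

(* The algebraic span when [g] is orthonormal; the expansion is required for all
   large [m] so that sums of two elements can be handled at a common [m]. *)
Definition span g : set H :=
  [set x | exists n, forall m, (n <= m)%N -> x = \sum_(k < m) '[x, g k] *: g k].

Lemma ip_orthonormal_sum g n (c : nat -> C) j : orthonormal_seq g ->
  '[\sum_(k < n) c k *: g k, g j] = if (j < n)%N then c j else 0.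
Proof.
move=> og; rewrite ip_suml; case: ifP => [ltjn|/negbT]; last first.
  rewrite -leqNgt => lenj; apply: big1 => i _.
  by rewrite ipZl og ltn_eqF ?mulr0// (leq_trans _ lenj).
rewrite (bigD1 (Ordinal ltjn))//= big1 ?addr0 => [|i ij].
  by rewrite ipZl og eqxx mulr1.
by rewrite ipZl og (negbTE (ij : (nat_of_ord i != j))) mulr0.
Qed.

Lemma span_gen g j : orthonormal_seq g -> span g (g j).
Proof.
move=> og; exists j.+1 => m ltjm; rewrite (bigD1 (Ordinal ltjm))//=.
rewrite big1 ?addr0 => [|i ij]; first by rewrite og eqxx scale1r.
by rewrite og eq_sym (negbTE (ij : (nat_of_ord i != j))) scale0r.
Qed.

Lemma subspace_span g : subspace (span g).
Proof.
split; first by exists 0%N => m _; rewrite big1// => k _; rewrite ip0l scale0r.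
move=> a x y [n xE] [m yE]; exists (maxn n m) => p; rewrite geq_max => /andP[np mp].
rewrite {1}(xE p np) {1}(yE p mp) scaler_sumr -big_split /=; apply: eq_bigr => k _.
by rewrite ipDl ipZl scalerDl scalerA.
Qed.

Lemma span_sub g X : subspace X -> (forall k, X (g k)) -> span g `<=` X.
Proof.
move=> sX Xg x [n /(_ n (leqnn n)) ->]; apply: subspace_sum => // k _.
exact: subspaceZ.
Qed.

(** Any [size Z + 1] of the [g k] have a nonzero combination orthogonal to [Z]. *)
Lemma big_span g : orthonormal_seq g -> big (span g).
Proof.
move=> og; split; first exact: subspace_span.
move=> Z; pose L : seq (nat -> C) := [seq (fun k => '[g k, z]) | z <- Z].
have [|t [i ltiN ti0] tL] := @underdetermined_system _ (size Z).+1 L.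
  by rewrite size_map.
pose x := \sum_(k < (size Z).+1) t k *: g k.
have x0 : x != 0.
  apply: contra_neq ti0 => x0; have := ip_orthonormal_sum (size Z).+1 t i og.
  by rewrite -/x x0 ip0l ltiN.
have [a na] := unit_normalize x0.
exists (a *: x).
  apply: subspaceZ; first exact: subspace_span.
  apply: subspace_sum; first exact: subspace_span.
  by move=> k _; apply: subspaceZ; [exact: subspace_span|exact: span_gen].
split=> // z zZ; rewrite ipZl ip_suml (_ : \sum_(k < _) _ = 0) ?mulr0//.
have lti : (index z Z < size Z)%N by rewrite index_mem.
rewrite -[RHS](tL (index z Z)) ?size_map//; apply: eq_bigr => k _.
by rewrite (nth_map 0)// nth_index// ipZl.
Qed.

(* [l] is the essential value of [A] on [X]: [<A x, x>] is close to [l |x|^2] on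
   subspaces of finite codimension, i.e. [A] compresses to [l] plus a compact. *)
Definition tends A l X := forall e, 0 < e -> exists Z, forall x, X x ->
  (forall z, z \in Z -> '[x, z] = 0) -> `|qform A x - l * sqn x| <= e * sqn x.

Lemma tends_sub A l X Y : Y `<=` X -> tends A l X -> tends A l Y.
Proof.
by move=> YX tA e e0; have [Z ZP] := tA e e0; exists Z => x /YX; exact: ZP.
Qed.

Lemma qformDZ (t : R) A B x : qform (t%:C *: A + B) x = t * qform A x + qform B x.
Proof. by rewrite /qform ipDl ipZl ReD ReRM. Qed.

Lemma tendsDZ t A B l m X : tends A l X -> tends B m X ->
  tends (t%:C *: A + B) (t * l + m) X.
Proof.
move=> tA tB e e0; have d0 : 0 < e / 2 / (`|t| + 1).
  by rewrite !divr_gt0// ltr_wpDl.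
have [Z ZP] := tA _ d0; have [Y YP] : exists Z, _ := tB (e / 2) ltac:(by rewrite divr_gt0).
exists (Z ++ Y) => x Xx xZY.
have {}ZP := ZP x Xx (fun z zZ => xZY z ltac:(by rewrite mem_cat zZ)).
have {}YP := YP x Xx (fun z zZ => xZY z ltac:(by rewrite mem_cat zZ orbT)).
rewrite qformDZ.
have -> : t * qform A x + qform B x - (t * l + m) * sqn x =
  t * (qform A x - l * sqn x) + (qform B x - m * sqn x) by ring.
apply: le_trans (ler_normD _ _) _; rewrite normrM.
have -> : e * sqn x = e / 2 * sqn x + e / 2 * sqn x by field.
apply: lerD => //; apply: le_trans (ler_wpM2l (normr_ge0 _) ZP) _.
rewrite mulrA ler_wpM2r ?sqn_ge0// mulrA ler_pdivrMr ?ltr_wpDl//.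
by rewrite mulrC ler_pM2l ?divr_gt0// lerDl.
Qed.

Lemma diag_form g A n (c d : nat -> C) : linear A ->
  (forall j k, j != k -> '[A (g j), g k] = 0) ->
  '[A (\sum_(k < n) c k *: g k), \sum_(k < n) d k *: g k] =
  \sum_(k < n) c k * (d k)^* * '[A (g k), g k].
Proof.
move=> lA dA; rewrite lin_sum// ip_suml; apply: eq_bigr => i _.
rewrite ip_sumr (bigD1 i)//= big1 ?addr0 => [|j ji].
  by rewrite linZ// ipZl ipZr mulrA.
by rewrite linZ// ipZl ipZr dA ?mulr0// eq_sym.
Qed.

(** For [x] orthogonal to the first [N] vectors, the form at [x] is a sum of diagonal entries of
    index at least [N], with weights [s k] adding up to [sqn x]. *)
Lemma diag_tends g A l : orthonormal_seq g -> linear A ->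
  (forall j k, j != k -> '[A (g j), g k] = 0) ->
  (forall e, 0 < e -> exists N, forall k, (N <= k)%N -> `|qform A (g k) - l| <= e) ->
  tends A l (span g).
Proof.
move=> og lA dA lim e e0; have [N NP] := lim e e0.
exists (mkseq g N) => x [n /(_ n (leqnn n)) xE] xZ.
pose c k := '[x, g k]; pose s k := complex.Re (c k) ^+ 2 + complex.Im (c k) ^+ 2.
have qE : qform A x = \sum_(k < n) s k * qform A (g k).
  rewrite /qform {1 2}xE (@diag_form g A n c c)// Re_sum.
  by apply: eq_bigr => k _; rewrite -normCK normC_sqr ReRM.
have sE : sqn x = \sum_(k < n) s k.
  rewrite -qform_id /qform {1 2}xE (@diag_form g idfun n c c)// => [|j k jk]; last first.
    by rewrite /= og (negbTE jk).
  rewrite Re_sum; apply: eq_bigr => k _.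
  by rewrite -normCK normC_sqr ReRM /= og eqxx mulr1.
rewrite qE sE !mulr_sumr -sumrB; apply: le_trans (ler_norm_sum _ _ _) _.
apply: ler_sum => k _; rewrite [l * _]mulrC -mulrBr normrM.
have s0 : 0 <= s k by rewrite addr_ge0 ?sqr_ge0.
rewrite (ger0_norm s0) mulrC; have [leNk|ltkN] := leqP N k.
  by rewrite ler_wpM2r// NP.
have ck0 : c k = 0.
  by apply: xZ; apply/mapP; exists (nat_of_ord k) => //; rewrite mem_iota.
by rewrite /s ck0 /= expr0n /= addr0 !mulr0.
Qed.

Lemma qform_bounded A : bounded_op A ->
  exists2 M : R, 0 <= M & forall x, '[x, x] = 1 -> `|qform A x| <= M.
Proof.
move=> [lA [M AM]]; exists `|complex.Re M| => // x nx.
have x1 : `|x| = 1.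
  by apply/eqP; rewrite -(@eqrXn2 _ 2)// ?expr1n ?sqr_norm_hdot ?nx.
have h : `|'[A x, x]| <= M.
  by apply: le_trans (cauchy_schwarz _ _) _; rewrite x1 mulr1; have := AM x; rewrite x1 mulr1.
have Mr : M = (complex.Re M)%:C by rewrite RRe_real// ger0_real// (le_trans _ h).
have : (`|qform A x|)%:C <= `|'[A x, x]|.
  rewrite normc_def lecR -sqrtr_sqr ler_sqrt ?lerDl ?sqr_ge0//.
  by rewrite addr_ge0 ?sqr_ge0.
by move=> /le_trans/(_ h); rewrite Mr lecR => /le_trans; apply; exact: ler_norm.
Qed.

(* [l] is the infimum over finite codimensional subspaces of the supremum of the
   quadratic form on unit vectors. *)
Lemma essential_value X A : big X -> bounded_op A ->
  exists l, forall e Z, 0 < e -> exists x, [/\ X x, '[x, x] = 1,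
    (forall z, z \in Z -> '[x, z] = 0) & `|qform A x - l| < e].
Proof.
move=> [_ bX] bA; have [M M0 AM] := qform_bounded bA.
pose S Z : set R := [set qform A x | x in
  [set x | [/\ X x, '[x, x] = 1 & forall z, z \in Z -> '[x, z] = 0]]].
have Sne Z : S Z !=set0.
  by have [x Xx [nx xZ]] := bX Z; exists (qform A x); exists x.
have Sub Z : has_ubound (S Z).
  by exists M => _ [x [_ nx _] <-]; rewrite (le_trans (ler_norm _))// AM.
have SleM Z : - M <= sup (S Z).
  have [r Sr] := Sne Z; apply: (@le_trans _ _ r); last exact: ub_le_sup.
  by have [x [_ nx _] <-] := Sr; rewrite lerNl (le_trans (ler_norm _))// normrN AM.
pose T : set R := range (fun Z => sup (S Z)).
have hT : has_inf T.
  by split; [exists (sup (S [::])); exists [::]|exists (- M) => _ [Z _ <-]].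
exists (inf T) => e Z e0.
(* [Z0] nearly attains the infimum. A nearly maximal unit vector orthogonal to both [Z0] and [Z] has
   its form value between [inf T - e] and [inf T + e]. *)
have [_ [Z0 _ <-] Z0e] := inf_adherent e0 hT.
have hS : has_sup (S (Z0 ++ Z)) by split.
have [_ [x [Xx nx xZ] <-] xe] := sup_adherent e0 hS.
exists x; split=> //; first by move=> z zZ; apply: xZ; rewrite mem_cat zZ orbT.
rewrite ltr_norml; apply/andP; split.
  rewrite ltrBrDl; apply: le_lt_trans xe; rewrite lerD2r.
  by apply: ge_inf; [case: hT|exists (Z0 ++ Z)].
rewrite ltrBlDl; apply: le_lt_trans Z0e; apply: ub_le_sup => //.
by exists x => //; split=> // z zZ; apply: xZ; rewrite mem_cat zZ.
Qed.

Lemma harmonic_small e : 0 < e ->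
  exists N, forall k, (N <= k)%N -> (k.+1%:R : R)^-1 <= e.
Proof.
move=> e0; have [N eN] := ltr_add_invr (ltac:(by rewrite add0r) : 0 < 0 + e).
exists N => k Nk; rewrite !add0r in eN; apply: le_trans (ltW eN).
by rewrite lef_pV2 ?posrE// ler_nat.
Qed.

Lemma orthonormal_seqP g :
  (forall n, '[g n, g n] = 1) ->
  (forall j n, (j < n)%N -> '[g n, g j] = 0) -> orthonormal_seq g.
Proof.
move=> ng og i j; case: ltngtP => [ij|ji|->]; last exact: ng.
  by rewrite ipC og ?rmorph0.
by rewrite og.
Qed.

(** Unit vectors orthogonal to the earlier [g j] and [A (g j)] make [A] diagonal; their form values
    are taken within [1/(n+1)] of the essential value. *)
Lemma thin1 A X : big X -> bounded_op A -> self_adjoint A ->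
  exists X' l, [/\ big X', X' `<=` X & tends A l X'].
Proof.
move=> bX bA sA; have [l lP] := essential_value bX bA.
pose Q (h : seq H) x := [/\ X x, '[x, x] = 1,
  (forall z, z \in h ++ map A h -> '[x, z] = 0) &
  `|qform A x - l| < (size h).+1%:R^-1].
have [|g gQ] := @choose_hist H 0 Q.
  by move=> h _; apply: lP; rewrite invr_gt0.
have og : orthonormal_seq g.
  apply: orthonormal_seqP => [n|j n jn]; first by have [] := gQ n.
  have [_ _ h _] := gQ n; apply: h; rewrite mem_cat; apply/orP; left.
  by apply/mapP; exists j => //; rewrite mem_iota.
have Aog j n : (j < n)%N -> '[g n, A (g j)] = 0.
  move=> jn; have [_ _ h _] := gQ n; apply: h; rewrite mem_cat; apply/orP; right.
  by apply: map_f; apply/mapP; exists j => //; rewrite mem_iota.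
exists (span g), l; split; first exact: big_span.
  by apply: span_sub; [case: bX|move=> k; have [] := gQ k].
apply: diag_tends => //; first by case: bA.
  move=> j k; case: ltngtP => // [jk|kj] _.
    by apply: ip_orthC; exact: Aog.
  by rewrite sA; exact: Aog.
move=> e e0; have [N NP] := harmonic_small e0; exists N => k Nk.
have [_ _ _] := gQ k; rewrite size_mkseq => /ltW/le_trans; apply; exact: NP.
Qed.

Lemma thin_family n (A : nat -> H -> H) X : big X ->
  (forall i, (i < n)%N -> bounded_op (A i) /\ self_adjoint (A i)) ->
  exists X' (l : nat -> R), [/\ big X', X' `<=` X &
    forall i, (i < n)%N -> tends (A i) (l i) X'].
Proof.
move=> bX; elim: n => [|n IH] hA; first by exists X, (fun=> 0); split=> //; exact: subset_refl.
have [|X1 [l [bX1 X1X tl]]] := IH; first by move=> i ltin; apply: hA; rewrite ltnW.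
have [bA sA] := hA n (ltnSn n).
have [X2 [m [bX2 X21 tm]]] := thin1 bX1 bA sA.
exists X2, (fun i => if i == n then m else l i); split=> //.
  exact: subset_trans X1X.
move=> i; rewrite ltnS leq_eqVlt; case: eqP => [-> //|_ /= ltin].
exact: tends_sub X21 (tl _ ltin).
Qed.

End Thinning.

(** * Diagonalizing sequences *)

Section OperatorSystem.
Context {R : realType} {H : hilbertType R}.
Local Notation C := R[i].
Implicit Types (x y z f : H) (a b : C) (A B : H -> H) (X : set H) (Z : seq H).
Implicit Types (l e t : R).

Lemma self_adjointDZ t A B : self_adjoint A -> self_adjoint B ->
  self_adjoint (t%:C *: A + B).
Proof.
by move=> sA sB x y; rewrite ipDl ipZl ipDr ipZr conjR sA sB.
Qed.

(** Evaluating the form at [x + z y] with [z = <A x, y>] leaves [2 |z|^2 = 0]. *)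
Lemma polarization X A : subspace X -> linear A -> self_adjoint A ->
  (forall x, X x -> qform A x = 0) -> forall x y, X x -> X y -> '[A x, y] = 0.
Proof.
move=> sX lA sA qA x y Xx Xy; set z := '[A x, y].
have q0 u : X u -> '[A u, u] = 0 by move=> Xu; rewrite qformE// qA.
have := q0 _ (subspaceD sX Xx (subspaceZ z sX Xy)).
rewrite linD// linZ// !ipDl !ipDr !ipZl !ipZr (q0 _ Xx) (q0 _ Xy).
rewrite (self_adjointC _ _ sA : '[A y, x] = _) -/z add0r !mulr0 addr0.
rewrite mulrC -normCK => /eqP.
by rewrite -mulr2n mulrn_eq0 /= sqrf_eq0 normr_eq0 => /eqP.
Qed.

Lemma qform_sum n (t : nat -> R) (A : nat -> H -> H) x :
  qform (\sum_(i < n) (t i)%:C *: A i) x = \sum_(i < n) t i * qform (A i) x.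
Proof.
rewrite /qform fct_sumE ip_suml Re_sum; apply: eq_bigr => i _.
by rewrite ipZl ReRM.
Qed.

Lemma ip_op_sum n (t : nat -> R) (A : nat -> H -> H) x y :
  '[(\sum_(i < n) (t i)%:C *: A i) x, y] = \sum_(i < n) (t i)%:C * '[A i x, y].
Proof.
by rewrite fct_sumE ip_suml; apply: eq_bigr => i _; rewrite ipZl.
Qed.

Lemma tends0 X : tends (0 : H -> H) 0 X.
Proof.
move=> e e0; exists [::] => x _ _.
by rewrite /qform ip0l mul0r subrr normr0 mulr_ge0 ?sqn_ge0// ltW.
Qed.

Lemma tends_sum n (t l : nat -> R) (A : nat -> H -> H) X :
  (forall i, (i < n)%N -> tends (A i) (l i) X) ->
  tends (\sum_(i < n) (t i)%:C *: A i) (\sum_(i < n) t i * l i) X.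
Proof.
elim: n => [|n IH] tA.
  by rewrite !big_ord0; exact: tends0.
rewrite !big_ord_recr /= addrC [X in tends _ X]addrC; apply: tendsDZ; first exact: tA.
by apply: IH => i ltin; apply: tA; rewrite ltnW.
Qed.

Variable V : set (H -> H).
Hypothesis systemV : operator_system V.

Definition sa_part A := V A /\ self_adjoint A.

Lemma sa_part_bounded A : sa_part A -> bounded_op A.
Proof. by case: systemV => bV _ _ _ [/bV]. Qed.

Lemma sa_part_linear A : sa_part A -> linear A.
Proof. by move=> /sa_part_bounded[]. Qed.

Lemma sa_partDZ t A B : sa_part A -> sa_part B -> sa_part (t%:C *: A + B).
Proof.
case: systemV => _ _ VD _ [VA sA] [VB sB]; split; first exact: VD.
exact: self_adjointDZ.
Qed.

Lemma sa_part_id : sa_part idfun.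
Proof. by case: systemV. Qed.

Lemma sa_part0 : sa_part 0.
Proof.
have := sa_partDZ (-1) sa_part_id sa_part_id; congr sa_part.
by rewrite rmorphN rmorph1 scaleN1r addNr.
Qed.

Lemma sa_part_sum n (t : nat -> R) (A : nat -> H -> H) :
  (forall i, (i < n)%N -> sa_part (A i)) -> sa_part (\sum_(i < n) (t i)%:C *: A i).
Proof.
elim: n => [|n IH] vA; first by rewrite big_ord0; exact: sa_part0.
rewrite big_ord_recr /= addrC; apply: sa_partDZ; first exact: vA.
by apply: IH => i ltin; apply: vA; rewrite ltnW.
Qed.

(** The number [n] leaves out the identity, whose form is [sqn]. Equality of forms on [X] is enough,
    because [polarization] recovers matrix entries from it. *)
Definition spanned_on X n (B : nat -> H -> H) :=
  (forall i, (i < n)%N -> sa_part (B i)) /\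
  forall A, sa_part A -> exists t (c : nat -> R), forall x, X x ->
    qform A x = t * sqn x + \sum_(i < n) c i * qform (B i) x.

Definition finite_compression n := exists X (B : nat -> H -> H), big X /\ spanned_on X n B.

(** * Null forms when no compression is finite dimensional *)

Section InfiniteCase.
Hypothesis infV : forall n, ~ finite_compression n.

(** If every form were a combination of the family and [sqn] on [X], the family would witness a
    finite compression; so some form lies outside and can be appended. *)
Lemma independent_family X N : big X -> exists A : nat -> H -> H,
  (forall i, (i < N)%N -> sa_part (A i)) /\
  forall t : nat -> R, (exists2 i, (i < N)%N & t i != 0) ->
    exists2 x, X x & \sum_(i < N) t i * qform (A i) x != 0.
Proof.
move=> bX; elim: N => [|N [A [vA iA]]]; first by exists (fun=> idfun); split=> // t [].
have [B [vB nB]] : exists B, sa_part B /\ forall t (c : nat -> R), exists2 x, X x &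
    qform B x != t * sqn x + \sum_(i < N) c i * qform (A i) x.
  apply: contrapT => nB; apply: (@infV N); exists X, A; split=> //; split=> // B vB.
  apply: contrapT => nt; apply: nB; exists B; split=> // t c.
  apply: contrapT => nx; apply: nt; exists t, c => x Xx.
  by apply/eqP; apply: contrapT => /negP nq; apply: nx; exists x.
exists (fun i => if i == N then B else A i); split.
  move=> i; rewrite ltnS leq_eqVlt; case: eqP => [_ _//|_ /= ltiN]; exact: vA.
move=> t [i leiN ti0].
have sumE x : \sum_(i < N.+1) t i * qform (if i == N :> nat then B else A i) x =
    \sum_(i < N) t i * qform (A i) x + t N * qform B x.
  rewrite big_ord_recr /= eqxx; congr (_ + _); apply: eq_bigr => k _.
  by rewrite ltn_eqF.
have [tN0|tN0] := eqVneq (t N) 0.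
  have [|x Xx xP] := iA t.
    exists i => //; move: leiN ti0; rewrite ltnS leq_eqVlt => /orP[/eqP->|//].
    by rewrite tN0 eqxx.
  by exists x => //; rewrite sumE tN0 mul0r addr0.
have [x Xx xP] := nB 0 (fun i => - t i / t N).
exists x => //; rewrite sumE; apply: contra_neq xP.
rewrite mul0r add0r => /eqP; rewrite addrC addr_eq0 => /eqP h.
apply: (mulfI tN0); rewrite h mulr_sumr -sumrN; apply: eq_bigr => k _.
by field.
Qed.

(* The coefficients of a combination of independent forms are chosen to kill both
   the finitely many prescribed values and the essential value. *)
Lemma null_form X (ys : seq H) : big X -> exists A f X',
  [/\ sa_part A, forall y z, y \in ys -> z \in ys -> '[A y, z] = 0,
      X f & qform A f != 0] /\ [/\ big X', X' `<=` X & tends A 0 X'].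
Proof.
(* The conditions are [m] real parts, [m] imaginary parts and one essential value; [N] exceeds their
   number by one. *)
move=> bX; pose m := (size ys * size ys)%N; pose N := (m + m + 1).+1.
have [A [vA iA]] := independent_family N bX.
have [|X' [l [bX' X'X tl]]] := @thin_family _ _ N A X bX.
  by move=> i /vA vAi; split; [exact: sa_part_bounded|case: vAi].
pose LR : seq (nat -> R) := [seq (fun i => complex.Re '[A i y, z]) | y <- ys, z <- ys].
pose LI : seq (nat -> R) := [seq (fun i => complex.Im '[A i y, z]) | y <- ys, z <- ys].
have [|t tn0 tL] := @underdetermined_system _ N (LR ++ LI ++ [:: l]).
  by rewrite !size_cat !size_allpairs /= addnA.
have {}tL phi : phi \in LR ++ LI ++ [:: l] -> \sum_(i < N) t i * phi i = 0.
  move=> phiL; have := tL (index phi (LR ++ LI ++ [:: l])).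
  by rewrite index_mem phiL => /(_ isT); under eq_bigr do rewrite nth_index//.
have [f Xf qf] := iA t tn0.
exists (\sum_(i < N) (t i)%:C *: A i), f, X'; split; split=> //.
- exact: sa_part_sum.
- move=> y z yys zys; rewrite ip_op_sum; apply/eqP; rewrite eq_complex.
  rewrite Re_sum Im_sum; apply/andP; split; apply/eqP.
    under eq_bigr do rewrite ReRM.
    apply: (tL (fun i => complex.Re '[A i y, z])); rewrite mem_cat; apply/orP; left.
    by apply/allpairsP; exists (y, z).
  under eq_bigr do rewrite ImRM.
  apply: (tL (fun i => complex.Im '[A i y, z])); rewrite !mem_cat; apply/orP; right.
  by apply/orP; left; apply/allpairsP; exists (y, z).
- by rewrite qform_sum.
rewrite -[X in tends _ X](tL l); first exact: tends_sum.
by rewrite !mem_cat inE eqxx !orbT.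
Qed.

(* Given two solutions (A1, f1), (A2, f2) for [zs], the second one chosen in the
   orthogonal of what the first one moves, all mixed terms vanish in
   [A1 + s A2], [f1 + b f2]; [b] is fixed by the condition on [z], and
   the resulting form cannot vanish for both [s = 1] and [s = -1]. *)
Lemma null_form_orth zs X ys : big X -> exists A f X',
  [/\ sa_part A, forall y z, y \in zs ++ ys -> z \in zs ++ ys -> '[A y, z] = 0,
      X f, qform A f != 0 & forall z, z \in zs -> '[A z, f] = 0] /\
  [/\ big X', X' `<=` X & tends A 0 X'].
Proof.
elim: zs X ys => [|z zs IH] X ys bX.
  have [A [f [X' [[? ? ? ?] ?]]]] := null_form ys bX; exists A, f, X'; split=> //.
(* With [z] moved to the second list, [A1] still vanishes on all prescribed vectors; the only
   condition lost is [<A1 z, f1> = 0]. *)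
have [A1 [f1 [X1 [[vA1 A1ys Xf1 qf1 A1zs] [bX1 X1X tA1]]]]] := IH X (z :: ys) bX.
have cE u : (u \in (z :: zs) ++ ys) = (u \in zs ++ z :: ys).
  by rewrite !(mem_cat, inE) orbCA orbA.
have [c10|c10] := eqVneq '[A1 z, f1] 0.
  exists A1, f1, X1; split=> //; split=> // [u v|u]; first by rewrite !cE; exact: A1ys.
  by rewrite inE => /predU1P[->//|]; exact: A1zs.
pose past := f1 :: zs ++ z :: ys.
(* Drawing [f2] from this orthogonal makes [<A1 u, f2>] vanish for [u] in [past], in particular for
   [u = f1]. *)
have bX1p := big_perp (map A1 past) bX1.
have [A2 [f2 [X2 [[vA2 A2ys [X1f2 f2p] qf2 A2zs] [bX2 X2X tA2]]]]] :=
  IH _ (z :: f1 :: ys) bX1p.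
have pE u : (u \in zs ++ z :: f1 :: ys) = (u \in past).
  by rewrite !(mem_cat, inE); do !case: eqP => ?; do !case: (_ \in _).
have X2X1 := subset_trans X2X (@sub_perp _ _ _ _).
have A2past u v : u \in past -> v \in past -> '[A2 u, v] = 0.
  by rewrite -!pE; exact: A2ys.
have pastS u : u \in zs ++ z :: ys -> u \in past by rewrite !inE => ->; rewrite orbT.
have f1p : f1 \in past by rewrite inE eqxx.
have zp : z \in past by rewrite !(inE, mem_cat) eqxx !orbT.
have A1f2 u : u \in past -> '[A1 u, f2] = 0.
  by move=> up; apply: ip_orthC; apply: f2p; exact: map_f.
have [c20|c20] := eqVneq '[A2 z, f2] 0.
  exists A2, f2, X2; split; split=> //.
  - by move=> u v; rewrite !cE => up vp; apply: A2past; exact: pastS.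
  - exact: X1X.
  - by move=> u; rewrite inE => /predU1P[->//|]; exact: A2zs.
  - exact: subset_trans X1X.
have lA1 := sa_part_linear vA1; have lA2 := sa_part_linear vA2.
have sA1 : self_adjoint A1 by case: vA1.
have A1f21 : '[A1 f2, f1] = 0 by rewrite sA1; apply: f2p; exact: map_f.
pose c1 := '[A1 z, f1]; pose c2 := '[A2 z, f2].
(* For [s ^+ 2 = 1] the entry of [A s] at [z] and [f s] is [c1 + b^* c2], which this [b] makes
   zero. *)
pose b := - (c1 / c2)^*.
pose A (s : R) := s%:C *: A2 + A1; pose f (s : R) := f1 + (s%:C * b) *: f2.
have AE s u : A s u = s%:C *: A2 u + A1 u by [].
have fE s : f s = f1 + (s%:C * b) *: f2 by [].
have vA s : sa_part (A s) by exact: sa_partDZ.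
(* Affine in [s], with slope [|b|^2 <A2 f2, f2>]; [b] is nonzero because [c1] and [c2] are. *)
have qfE s : s ^+ 2 = 1 -> qform (A s) (f s) = (qform A1 f1 +
   complex.Re (`|b| ^+ 2 * '[A1 f2, f2] + (b^* * '[A2 f1, f2] + b * '[A2 f2, f1])))
   + s * complex.Re (`|b| ^+ 2 * '[A2 f2, f2]).
  move=> s1; have sC1 : (s%:C : C) * s%:C = 1 by rewrite -rmorphM -expr2 s1.
  rewrite -ReRM -ReD -ReD; congr complex.Re.
  rewrite AE fE ipDl ipZl (linD _ _ lA1) (linD _ _ lA2) (linZ _ _ lA1) (linZ _ _ lA2).
  rewrite !ipDl !ipDr !ipZl !ipZr.
  rewrite (A2past _ _ f1p f1p) (A1f2 _ f1p) A1f21 rmorphM /= conjR normCK.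
  by ring: sC1.
have [s [s1 qs]] : exists s, s ^+ 2 = 1 /\ qform (A s) (f s) != 0.
  apply: contrapT => ns; have q0 s : s ^+ 2 = 1 -> qform (A s) (f s) = 0.
    by move=> s1; apply: contrapT => /eqP qs; apply: ns; exists s.
  have := q0 1 (expr1n _ _); have := q0 (-1) ltac:(by rewrite sqrrN expr1n).
  rewrite !qfE ?sqrrN ?expr1n// => q1 q2.
  have b0 : complex.Re b ^+ 2 + complex.Im b ^+ 2 != 0.
    rewrite -(inj_eq (@complexI R)) -normC_sqr sqrf_eq0 normr_eq0 oppr_eq0.
    by rewrite conjC_eq0 mulf_eq0 invr_eq0 negb_or c10 c20.
  move: (mulf_neq0 b0 qf2); rewrite /qform -ReRM -normC_sqr => /eqP; apply; lra.
exists (A s), (f s), X2; split; split=> //.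
- move=> u v; rewrite !cE => up vp; rewrite AE ipDl ipZl A1ys//.
  by rewrite A2past ?mulr0 ?addr0//; exact: pastS.
- case: bX => sX _; apply: subspaceD => //; apply: subspaceZ => //; exact: X1X.
- have bc : b^* * c2 + c1 = 0.
    by rewrite /b rmorphN /= conjCK mulNr divfK// addNr.
  move=> u uzs; have up : u \in past by apply: pastS; rewrite -cE mem_cat uzs.
  rewrite AE fE ipDl ipZl !ipDr !ipZr A2past// A1f2// rmorphM /= conjR.
  have -> : s%:C * (0 + s%:C * b^* * '[A2 u, f2]) = (s ^+ 2)%:C * (b^* * '[A2 u, f2]).
    by rewrite expr2 rmorphM; ring.
  rewrite s1 mul1r mulr0 addr0; move: uzs; rewrite inE => /predU1P[->//|uzs].
  by rewrite A2zs// A1zs// mulr0 addr0.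
- exact: subset_trans X1X.
- have := tendsDZ s tA2 (tends_sub X2X1 tA1).
  by rewrite mulr0 addr0.
Qed.

(** Each stage stores an operator, its vector and the subspace [X] from which all later vectors are
    drawn. The pair comes from [null_form_orth] with the earlier vectors as [zs], then is
    normalized. The constant [2^-(n+2)] is chosen because its sum over [n] is at most one half,
    which [triangular_injective] needs. *)
Lemma diagonalizing_sequence : big [set: H] ->
  exists (A : nat -> H -> H) (f : nat -> H), orthonormal_seq f /\ forall n,
  [/\ sa_part (A n), forall j k, j != k -> '[A n (f j), f k] = 0,
      forall k, (k < n)%N -> '[A n (f k), f k] = 0, '[A n (f n), f n] = 1 &
      forall k, (n < k)%N -> `|qform (A n) (f k)| <= 2^-1 ^+ n.+2].
Proof.
move=> bH; pose T : Type := ((H -> H) * H * set H)%type; pose t0 : T := (0, 0, setT).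
pose Q (h : seq T) (t : T) : Prop :=
  let: (A, f, X) := t in let n := size h in
  let A_ i := (nth t0 h i).1.1 in let f_ i := (nth t0 h i).1.2 in
  let X_ i := (nth t0 h i).2 in
  [/\ sa_part A, forall i j, (i < n)%N -> (j < n)%N -> '[A (f_ i), f_ j] = 0,
      forall i, (i < n)%N -> '[A (f_ i), f] = 0, '[A f, f] = 1 & '[f, f] = 1] /\
  [/\ big X, forall i, (i < n)%N -> X `<=` X_ i, forall i, (i < n)%N -> X_ i f,
      forall x, X x -> [/\ '[x, f] = 0, '[x, A f] = 0 &
        forall i, (i < n)%N -> '[x, A (f_ i)] = 0 /\ '[x, A_ i f] = 0] &
      forall x, X x -> `|qform A x| <= 2^-1 ^+ n.+2 * sqn x].
have [|g gQ] := @choose_hist T t0 Q.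
  move=> h hQ.
  have [X0 [bX0 X0X]] : exists X0, big X0 /\
      forall i, (i < size h)%N -> X0 `<=` (nth t0 h i).2.
    case: (posnP (size h)) => [->|h0]; first by exists setT.
    have ltm : ((size h).-1 < size h)%N by rewrite prednK.
    exists (nth t0 h (size h).-1).2; have := hQ _ ltm.
    rewrite /Q; case E: (nth t0 h (size h).-1) => [[A f] X] [_ [bX XX _ _ _]].
    split=> // i lti; have [lti'|] := ltnP i (size h).-1.
      have := XX i; rewrite size_take ltm nth_take// => /(_ lti').
      by apply: subset_trans.
    move=> lei; have -> : i = (size h).-1.
      by apply/eqP; rewrite eqn_leq lei andbT -ltnS prednK.
    by rewrite E; exact: subset_refl.
  pose fs := map (fun t : T => t.1.2) h.
  have [A [f [X' [[vA A0 X0f qf Af] [bX' X'X0 tA]]]]] := @null_form_orth fs X0 [::] bX0.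
  rewrite cats0 in A0; have lA := sa_part_linear vA.
  have f0 : f != 0 by apply: contra_neq qf => ->; rewrite /qform ip0r.
  have [a na] := unit_normalize f0; pose u := a *: f.
  have qu : qform A u != 0.
    rewrite qformZ// mulf_neq0// -(inj_eq (@complexI R)) -normC_sqr sqrf_eq0 normr_eq0.
    by apply: contra_eq_neq na => ->; rewrite scale0r ip0l eq_sym oner_eq0.
  pose r := (qform A u)^-1; pose B := r%:C *: A + 0.
  have BE x : B x = r%:C *: A x by rewrite -[RHS]addr0.
  have vB : sa_part B by apply: sa_partDZ => //; exact: sa_part0.
  have tB : tends B 0 X'
    by have := tendsDZ r tA (tends0 X'); rewrite (_ : r * 0 + 0 = 0)// mulr0 addr0.
  have e0 : 0 < 2^-1 ^+ (size h).+2 :> R by rewrite exprn_gt0// invr_gt0.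
  have [Z ZP] := tB _ e0.
  (* Later vectors must avoid both the new operator at old vectors and the old operators at the new
     vector; [Z] makes the form of [B] small on them. *)
  exists (B, u, perp X' (u :: B u :: map B fs ++ map (fun t : T => t.1.1 u) h ++ Z)).
  have fsP i : (i < size h)%N -> (nth t0 h i).1.2 \in fs.
    by move=> lti; apply/(nthP 0); exists i; rewrite ?size_map// (nth_map t0).
  split; split=> //.
  - by move=> i j lti ltj; rewrite BE ipZl A0 ?mulr0//; exact: fsP.
  - by move=> i lti; rewrite BE ipZl ipZr Af ?mulr0//; exact: fsP.
  - by rewrite BE ipZl qformE; [rewrite -rmorphM mulVf|case: vA].
  - exact: big_perp.
  - by move=> i lti x [/X'X0 X0x _]; exact: X0X.
  - move=> i lti; apply: (X0X i lti); apply: subspaceZ => //; by case: bX0.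
  - move=> x [X'x xZ]; split=> [||i lti]; [| |split]; apply: xZ;
      rewrite !(inE, mem_cat) ?eqxx ?orbT//.
      by rewrite map_f ?orbT//; exact: fsP.
    suff -> : (nth t0 h i).1.1 u \in map (fun t : T => t.1.1 u) h by rewrite !orbT.
    by apply/(nthP 0); exists i; rewrite ?size_map// (nth_map t0).
  - move=> x [X'x xZ]; have := ZP x X'x; rewrite mul0r subr0; apply=> z zZ.
    by apply: xZ; rewrite !(inE, mem_cat) zZ !orbT.
pose A n := (g n).1.1; pose f n := (g n).1.2; pose X n := (g n).2.
exists A, f.
have P n : [/\ sa_part (A n), forall i j, (i < n)%N -> (j < n)%N -> '[A n (f i), f j] = 0,
      forall i, (i < n)%N -> '[A n (f i), f n] = 0, '[A n (f n), f n] = 1 &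
      '[f n, f n] = 1] /\
  [/\ forall i, (i < n)%N -> X i (f n),
      forall x, X n x -> [/\ '[x, f n] = 0, '[x, A n (f n)] = 0 &
        forall i, (i < n)%N -> '[x, A n (f i)] = 0 /\ '[x, A i (f n)] = 0] &
      forall x, X n x -> `|qform (A n) x| <= 2^-1 ^+ n.+2 * sqn x].
  have := gQ n; rewrite /Q /A /f /X; case: (g n) => [[A' f'] X'] /=.
  rewrite size_mkseq => -[[vA h1 h2 h3 h4] [bX h5 h6 h7 h8]].
  split; split=> //.
  - by move=> i j lti ltj; have := h1 i j lti ltj; rewrite !nth_mkseq.
  - by move=> i lti; have := h2 i lti; rewrite nth_mkseq.
  - by move=> i lti; have := h6 i lti; rewrite nth_mkseq.
  - move=> x /h7[? ? h9]; split=> // i lti; have := h9 i lti; rewrite nth_mkseq//.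
(* For [k <= n] this is the choice of [A n] and [f n]. For [n < k], the vector [f k] lies in the
   subspace of the later of the stages [n] and [j], which is orthogonal to [A n (f j)]. *)
have off n j k : (j < k)%N -> '[A n (f j), f k] = 0.
  move=> jk; have [[vA h1 h2 _ _] _] := P n.
  have [kn|nk|kn] := ltngtP k n; last by rewrite kn h2// -kn.
    by apply: h1 => //; exact: ltn_trans kn.
  apply: ip_orthC; have [nj|jn|nj] := ltngtP n j.
  - have [_ [h _ _]] := P k; have [_ [_ hj _]] := P j.
    by have [_ _ /(_ n nj)[_]] := hj _ (h j jk).
  - have [_ [h _ _]] := P k; have [_ [_ hn _]] := P n.
    by have [_ _ /(_ j jn)[]] := hn _ (h n nk).
  - have [_ [h _ _]] := P k; have [_ [_ hn _]] := P n.
    by have [_] := hn _ (h n nk); rewrite nj.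
split.
  apply: orthonormal_seqP => [n|j n jn]; first by have [[]] := P n.
  have [_ [h _ _]] := P n; have [_ [_ hj _]] := P j.
  by have [] := hj _ (h j jn).
move=> n; have [[vA h1 h2 h3 h4] [h5 h6 h7]] := P n; split=> //.
- move=> j k; case: ltngtP => // [jk|kj] _; first exact: off.
  by rewrite self_adjointC ?off ?conjC0//; case: vA.
- by move=> k kn; exact: h1.
- move=> k nk; have [[_ _ _ _ nf] [hk _ _]] := P k.
  have := h7 _ (hk n nk); suff -> : sqn (f k) = 1 by rewrite mulr1.
  by rewrite /sqn nf.
Qed.

End InfiniteCase.
End OperatorSystem.

(** * Projections onto closed spans *)

Section Projection.
Context {R : realType} {H : hilbertType R}.
Local Notation C := R[i].
Implicit Types (x y z : H) (a b : C) (A B : H -> H) (g : nat -> H) (c : nat -> C).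

Lemma norm_sqn x : `|x| = (Num.sqrt (sqn x))%:C.
Proof.
apply/eqP; rewrite -(@eqrXn2 _ 2)// ?ler0c ?sqrtr_ge0//.
by rewrite sqr_norm_hdot sqnE -rmorphXn /= sqr_sqrtr ?sqn_ge0.
Qed.

Lemma gt0C (e : C) : 0 < e -> exists2 r : R, 0 < r & e = r%:C.
Proof.
move=> e0; have er : e = (complex.Re e)%:C by rewrite RRe_real// gtr0_real.
by exists (complex.Re e) => //; rewrite -ltcR -er.
Qed.

(** Tolerances are taken in [R]: a positive element of [R[i]] is a positive real. *)
Lemma limP (U : normedModType C) (u : nat -> U) (l : U) :
  u n @[n --> \oo] --> l <->
  forall e : R, 0 < e -> exists N, forall n, (N <= n)%N -> `|l - u n| <= e%:C.
Proof.
split=> [/cvgrPdist_le h e e0|h].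
  by have [|N _ hN] := h e%:C; [rewrite ltcR|exists N].
apply/cvgrPdist_le => _ /gt0C[r r0 ->]; have [N hN] := h r r0.
by exists N.
Qed.

Lemma lim_unique (U : normedModType C) (u : nat -> U) (l m : U) :
  u n @[n --> \oo] --> l -> u n @[n --> \oo] --> m -> l = m.
Proof. by apply: cvg_unique; exact: norm_hausdorff. Qed.

Lemma lim_eventually (U : normedModType C) (u : nat -> U) (l : U) N :
  (forall n, (N <= n)%N -> u n = l) -> u n @[n --> \oo] --> l.
Proof. by move=> uN; apply: cvg_near_cst; exists N. Qed.

Lemma eq_lim (U : normedModType C) (u v : nat -> U) (l : U) :
  (forall n, v n = u n) -> u n @[n --> \oo] --> l -> v n @[n --> \oo] --> l.
Proof. by move=> uv; rewrite (_ : v = u)//; apply/funext. Qed.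

Lemma limDZ (U : normedModType C) a (u v : nat -> U) (l m : U) :
  u n @[n --> \oo] --> l -> v n @[n --> \oo] --> m ->
  (a *: u n + v n) @[n --> \oo] --> a *: l + m.
Proof. by move=> ul vm; apply: cvgD => //; apply: cvgZ => //; exact: cvg_cst. Qed.

Arguments limDZ {U} a {u v l m}.

Lemma lim_lipschitz (U W : normedModType C) (F : U -> W) (M : C) (u : nat -> U) l :
  (forall x y : U, `|F x - F y| <= M * `|x - y|) ->
  u n @[n --> \oo] --> l -> F (u n) @[n --> \oo] --> F l.
Proof.
move=> FM /limP ul; apply/limP => e e0.
have e0' : 0 < e / (`|complex.Re M| + 1) by rewrite divr_gt0// ltr_wpDl.
have [N hN] := ul _ e0'; exists N => n /hN lun.
have [->|lu0] := eqVneq l (u n); first by rewrite subrr normr0 ler0c ltW.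
have Mr : M \is Num.real.
  have lun0 : `|l - u n| != 0 by rewrite normr_eq0 subr_eq0.
  rewrite -(mulfK lun0 M) rpredM ?rpredV ?normr_real//.
  by rewrite ger0_real// (le_trans _ (FM _ _)).
apply: le_trans (FM _ _) _.
apply: (@le_trans _ _ ((`|complex.Re M| + 1)%:C * `|l - u n|)).
  rewrite ler_wpM2r// -(RRe_real Mr) lecR (le_trans (ler_norm _))//.
  by rewrite /= lerDl.
apply: (@le_trans _ _ ((`|complex.Re M| + 1)%:C * (e / (`|complex.Re M| + 1))%:C)).
  by rewrite ler_wpM2l// ler0c addr_ge0.
by rewrite -rmorphM lecR mulrC divfK// gt_eqF// ltr_wpDl.
Qed.

Lemma lim_bounded_op A (u : nat -> H) l : bounded_op A ->
  u n @[n --> \oo] --> l -> A (u n) @[n --> \oo] --> A l.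
Proof.
move=> [lA [M AM]]; apply: (@lim_lipschitz _ _ _ M) => x y.
by rewrite -linB.
Qed.

Lemma lim_ipl (u : nat -> H) l y :
  u n @[n --> \oo] --> l -> '[u n, y] @[n --> \oo] --> ('[l, y] : C^o).
Proof.
apply: (@lim_lipschitz _ C^o (fun x => '[x, y]) `|y|) => x z.
by rewrite -ipBl mulrC; exact: cauchy_schwarz.
Qed.

Lemma lim_ipr (u : nat -> H) l y :
  u n @[n --> \oo] --> l -> '[y, u n] @[n --> \oo] --> ('[y, l] : C^o).
Proof.
apply: (@lim_lipschitz _ C^o (fun x => '[y, x]) `|y|) => x z.
by rewrite -ipBr; exact: cauchy_schwarz.
Qed.

Arguments lim_ipl {u l} y _.
Arguments lim_ipr {u l} y _.

Definition psum g c n := \sum_(k < n) c k *: g k.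

Definition sqC a : R := complex.Re a ^+ 2 + complex.Im a ^+ 2.

Lemma sqn_psum g c n : orthonormal_seq g -> sqn (psum g c n) = \sum_(k < n) sqC (c k).
Proof.
move=> og; rewrite /psum sqn_sum//; apply: eq_bigr => k _.
by rewrite sqnZ /sqn og eqxx mulr1.
Qed.

Lemma psumB g c m n : (m <= n)%N ->
  psum g c n - psum g c m = psum g (fun k => if (m <= k)%N then c k else 0) n.
Proof.
move=> mn; rewrite /psum -!(big_mkord predT (fun k => c k *: g k)).
rewrite (big_cat_nat (leq0n m) mn)//= addrAC subrr add0r.
rewrite -(big_mkord predT (fun k => (if (m <= k)%N then c k else 0) *: g k)).
rewrite (big_cat_nat (leq0n m) mn)//= [X in _ = X + _]big_nat_cond.
rewrite [X in _ = X + _]big1 ?add0r => [|k].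
  by rewrite !big_nat; apply: eq_bigr => k /andP[-> _].
by rewrite andbT ltnNge => /negbTE->; rewrite scale0r.
Qed.

Lemma riesz_fischer g c (M : R) : orthonormal_seq g ->
  (forall n, \sum_(k < n) sqC (c k) <= M) ->
  exists y, psum g c n @[n --> \oo] --> y.
Proof.
move=> og cM; pose s n := \sum_(k < n) sqC (c k).
have hs : has_sup (range s).
  by split; [exists (s 0%N); exists 0%N|exists M => _ [n _ <-]; exact: cM].
suff : cvg (psum g c n @[n --> \oo]) by move=> h; exists (lim (psum g c n @[n --> \oo])).
apply: cauchy_cvg; apply: cauchy_exP => _ /gt0C[e e0 ->].
(* The partial sum at [N] is within [e ^+ 2] of the supremum, so every later block has squared norm
   below [e ^+ 2]. *)
have [_ [N _ <-] Ne] := sup_adherent (exprn_gt0 2 e0) hs.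
exists (psum g c N), N => // n /= Nn; rewrite -ball_normE /= distrC norm_sqn ltcR.
rewrite -(@ltr_pXn2r _ 2)// ?nnegrE ?sqrtr_ge0 ?ltW// sqr_sqrtr ?sqn_ge0//.
rewrite psumB// sqn_psum//.
have : s n <= sup (range s) by apply: ub_le_sup; [case: hs|exists n].
suff -> : s n = s N + \sum_(k < n) sqC (if (N <= k)%N then c k else 0) by lra.
rewrite /s -!(big_mkord predT (fun k => sqC (c k))).
rewrite -(big_mkord predT (fun k => sqC (if (N <= k)%N then c k else 0))).
rewrite (big_cat_nat (leq0n N) Nn)//= [in RHS](big_cat_nat (leq0n N) Nn)//=; congr (_ + _).
rewrite [X in _ = X + _]big_nat_cond [X in _ = X + _]big1 ?add0r => [|k].
  by rewrite !big_nat; apply: eq_bigr => k /andP[-> _].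
by rewrite andbT ltnNge => /negbTE->; rewrite /sqC /= expr0n addr0.
Qed.

Lemma lim_coef g c y : orthonormal_seq g -> psum g c n @[n --> \oo] --> y ->
  forall j, '[y, g j] = c j.
Proof.
move=> og cy j; apply: (@lim_unique C^o _ _ _ (lim_ipl (g j) cy)).
apply: (@lim_eventually C^o _ _ j.+1) => n jn.
by rewrite /psum (ip_orthonormal_sum _ _ _ og) jn.
Qed.

Lemma bessel g x n : orthonormal_seq g -> \sum_(k < n) sqC '[x, g k] <= sqn x.
Proof.
move=> og; pose c k := '[x, g k]; pose S := psum g c n.
have cC k : c k * (c k)^* = (sqC (c k))%:C by rewrite -normCK normC_sqr.
have SS : '[S, S] = (\sum_(k < n) sqC (c k))%:C by rewrite sqnE sqn_psum.
have xS : '[x, S] = (\sum_(k < n) sqC (c k))%:C.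
  rewrite ip_sumr rmorph_sum; apply: eq_bigr => k _.
  by rewrite ipZr mulrC cC.
have := sqn_ge0 (x - S).
rewrite /sqn ipBl !ipBr SS xS [in '[S, x]]ipC xS conjR.
by rewrite !(ReD, ReN) /= subrr subr0 subr_ge0.
Qed.

(** The projection onto the closed span of [g], as a Fourier series; convergence relies on [g] being
    orthonormal, through [bessel] and [riesz_fischer]. *)
Definition proj g x : H := lim (psum g (fun k => '[x, g k]) n @[n --> \oo]).

Section ProjectionOnto.
Variables (g : nat -> H) (og : orthonormal_seq g).

Lemma proj_cvg x : psum g (fun k => '[x, g k]) n @[n --> \oo] --> proj g x.
Proof.
have [y yP] :=
  @riesz_fischer g (fun k => '[x, g k]) _ og (fun n => bessel x n og).
by apply: cvgP yP.
Qed.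

Arguments proj_cvg : clear implicits.

Lemma projE x y : psum g (fun k => '[x, g k]) n @[n --> \oo] --> y -> proj g x = y.
Proof. exact: (lim_unique (proj_cvg x)). Qed.

Lemma proj_lim c y : psum g c n @[n --> \oo] --> y -> proj g y = y.
Proof.
move=> cy; apply: projE; have h := lim_coef og cy.
by rewrite (_ : (fun k => '[y, g k]) = c)//; apply/funext.
Qed.

Lemma proj_proj x : proj g (proj g x) = proj g x.
Proof. exact: proj_lim (proj_cvg x). Qed.

Lemma proj_gen j : proj g (g j) = g j.
Proof.
apply: (@proj_lim (fun k => (j == k)%:R)); apply: (@lim_eventually _ _ _ j.+1) => n jn.
rewrite /psum (bigD1 (Ordinal jn))//= eqxx scale1r big1 ?addr0// => k kj.
by rewrite eq_sym (negbTE (kj : (nat_of_ord k != j))) scale0r.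
Qed.

Lemma proj_linear : linear (proj g).
Proof.
move=> a x y; apply: projE; apply: eq_lim (limDZ a (proj_cvg x) (proj_cvg y)) => n.
rewrite /psum /= scaler_sumr -big_split /=; apply: eq_bigr => k _.
by rewrite ipDl ipZl scalerDl scalerA.
Qed.

Lemma proj_sa : self_adjoint (proj g).
Proof.
move=> x y; apply: (@lim_unique C^o _ _ _ (lim_ipl y (proj_cvg x))).
apply: (@eq_lim C^o _ _ _ _ (lim_ipr x (proj_cvg y))) => n.
rewrite /psum ip_suml ip_sumr; apply: eq_bigr => k _.
by rewrite ipZl ipZr -ipC mulrC.
Qed.

Lemma proj_norm x : `|proj g x| <= `|x|.
Proof.
have [->|Px0] := eqVneq (proj g x) 0; first by rewrite normr0.
have p0 : 0 < `|proj g x| by rewrite normr_gt0.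
rewrite -(ler_pM2r p0); have := cauchy_schwarz x (proj g x).
have -> : '[x, proj g x] = `|proj g x| ^+ 2.
  by rewrite sqr_norm_hdot proj_sa proj_proj.
by rewrite ger0_norm ?exprn_ge0// expr2.
Qed.

Lemma proj_bounded : bounded_op (proj g).
Proof.
split; first exact: proj_linear.
by exists 1 => x; rewrite mul1r; exact: proj_norm.
Qed.

Lemma projection_proj : projection (proj g).
Proof.
split; [exact: proj_bounded|by apply/funext => x /=; exact: proj_proj|].
exact: proj_sa.
Qed.

Lemma proj_eq0 x : (forall k, '[x, g k] = 0) -> proj g x = 0.
Proof.
move=> x0; apply: projE; apply: (@lim_eventually _ _ _ 0) => n _.
by rewrite /psum big1// => k _; rewrite x0 scale0r.
Qed.

Lemma proj_infinite_rank : infinite_rank (proj g).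
Proof.
move=> [s sP].
have /choice[c cP] i : exists c : nat -> C, g i = \sum_(j < size s) c j *: s`_j.
  by apply/lin_spanP; rewrite -sP; exists (g i) => //; exact: proj_gen.
pose L := mkseq (fun j i => c i j) (size s).
have [|t [i lti ti0] tL] := @underdetermined_system _ (size s).+1 L.
  by rewrite size_mkseq.
move/eqP: ti0; apply; have := ip_orthonormal_sum (size s).+1 t i og.
rewrite lti => <-; rewrite (_ : \sum_(k < _) _ = 0) ?ip0l//.
under eq_bigr do rewrite cP scaler_sumr.
rewrite exchange_big /= big1// => j _.
under eq_bigr do rewrite scalerA.
rewrite -scaler_suml; have := tL j; rewrite size_mkseq ltn_ord nth_mkseq//.
by move=> ->//; rewrite scale0r.
Qed.

Lemma lim_op_proj A x : bounded_op A ->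
  psum (A \o g) (fun k => '[x, g k]) n @[n --> \oo] --> A (proj g x).
Proof.
move=> bA; apply: eq_lim (lim_bounded_op bA (proj_cvg x)) => n; case: bA => lA _.
by rewrite /psum lin_sum//; apply: eq_bigr => k _ /=; rewrite linZ.
Qed.

Arguments lim_op_proj : clear implicits.

Lemma bounded_comp A B : bounded_op A -> bounded_op B -> bounded_op (A \o B).
Proof.
move=> [lA [M AM]] [lB [N BN]]; split.
  by move=> a x y /=; rewrite lB lA.
exists (`|M| * N) => x /=; apply: le_trans (AM _) _.
have Mr : M * `|B x| \is Num.real by rewrite ger0_real// (le_trans _ (AM _)).
apply: (@le_trans _ _ (`|M| * `|B x|)).
  by rewrite (le_trans (real_ler_norm _))// ?normrM ?normr_id.
by rewrite -mulrA ler_wpM2l.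
Qed.

(** [A (g k)] may leave the closed span, but it projects to [d k *: g k], since the difference is
    orthogonal to every [g j]. Continuity does the rest. *)
Lemma compression_diag A d : bounded_op A ->
  (forall j k, '[A (g j), g k] = if j == k then d j else 0) ->
  forall x, psum g (fun k => '[x, g k] * d k) n @[n --> \oo]
    --> (proj g \o A \o proj g) x.
Proof.
move=> bA Ad x; apply: eq_lim (lim_op_proj _ x (bounded_comp proj_bounded bA)) => n.
rewrite /psum; apply: eq_bigr => k _ /=; rewrite -scalerA; congr (_ *: _).
have lP := proj_linear.
rewrite -{1}(proj_gen k) -(linZ _ _ lP); apply/eqP; rewrite -subr_eq0 -(linB _ _ lP).
apply/eqP; apply: proj_eq0 => j; rewrite ipBl ipZl Ad og.
by case: eqP => [->|_]; rewrite ?mulr1 ?mulr0 subrr.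
Qed.

End ProjectionOnto.
End Projection.
Arguments lim_ipl {R H u l} y.
Arguments lim_ipr {R H u l} y.
Arguments limDZ {R U} a {u v l m}.
Arguments proj_cvg {R H g} og x.
Arguments lim_op_proj {R H g} og A x.
Arguments compression_diag {R H g} og {A d} bA Ad x.

(** * Compact diagonal operators *)

Lemma geom_tail (R : realType) N n :
  \sum_(k < n) (if (N <= k)%N then 2^-1 ^+ k else 0) <= 2 * 2^-1 ^+ N :> R.
Proof.
(* The remainder of the geometric series is added to obtain a bound that is preserved by
   induction. *)
suff : \sum_(k < n) (if (N <= k)%N then 2^-1 ^+ k else 0) + 2 * 2^-1 ^+ maxn n N
    <= 2 * 2^-1 ^+ N :> R.
  by apply: le_trans; rewrite lerDl mulr_ge0// exprn_ge0// invr_ge0.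
elim: n => [|n IH]; first by rewrite big_ord0 add0r max0n.
rewrite big_ord_recr /=; have [leNn|ltnN] := leqP N n.
  rewrite (maxn_idPl (leqW leNn)) exprS.
  by move: IH; rewrite (maxn_idPl leNn); lra.
by rewrite addr0 (maxn_idPr ltnN); move: IH; rewrite (maxn_idPr (ltnW ltnN)).
Qed.

Lemma sum_head_le (R : realType) (s : R) N n : 0 <= s ->
  \sum_(k < n) (if (k < N)%N then s else 0) <= N%:R * s.
Proof.
move=> s0; suff : \sum_(k < n) (if (k < N)%N then s else 0) <= (minn n N)%:R * s.
  by move=> /le_trans; apply; rewrite ler_wpM2r// ler_nat geq_minr.
elim: n => [|n IH]; first by rewrite big_ord0 min0n mul0r.
rewrite big_ord_recr /=; have [ltnN|leNn] := ltnP n N.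
  by move: IH; rewrite (minn_idPl ltnN) (minn_idPl (ltnW ltnN)) -[n.+1%:R]natr1; lra.
by rewrite addr0; move: IH; rewrite !(minn_idPr _)// leqW.
Qed.

Section Compactness.
Context {R : realType} {H : hilbertType R}.
Local Notation C := R[i].
Implicit Types (x y z : H) (a b : C) (A B : H -> H).

Lemma sqCD a b : sqC (a + b) <= 2 * (sqC a + sqC b).
Proof.
case: a b => [a1 a2] [b1 b2]; rewrite /sqC /=.
by have := sqr_ge0 (a1 - b1); have := sqr_ge0 (a2 - b2); nra.
Qed.

Lemma sqn_le_norm x (e : R) : 0 <= e -> sqn x <= e ^+ 2 -> `|x| <= e%:C.
Proof.
move=> e0 xe; rewrite norm_sqn lecR -(@ler_pXn2r _ 2)// ?nnegrE ?sqrtr_ge0//.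
by rewrite sqr_sqrtr ?sqn_ge0.
Qed.

Lemma sqn_proj_le (g : nat -> H) x (M : R) : orthonormal_seq g -> 0 <= M -> proj g x = x ->
  (forall n, \sum_(k < n) sqC '[x, g k] <= M ^+ 2) -> `|x| <= M%:C.
Proof.
move=> og M0 Px xM; apply/ler_addgt0Pr => _ /gt0C[e e0 ->].
have := proj_cvg og x; rewrite Px => /limP/(_ e e0)[N /(_ N (leqnn N)) hN].
rewrite -[x](subrK (psum g (fun k => '[x, g k]) N)) (le_trans (ler_normD _ _))// addrC.
by apply: lerD => //; apply: sqn_le_norm => //; rewrite sqn_psum.
Qed.

(** Compactness of the segment gives a cluster point, and an ultrafilter converges to its cluster
    points. *)
Lemma ultra_segment (T : Type) (F : set_system T) (f : T -> R) (d : R) :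
  UltraFilter F -> F [set y | `|f y| <= d] ->
  exists2 r, `|r| <= d & forall e : R, 0 < e -> F [set y | `|r - f y| <= e].
Proof.
move=> UF Fd; have PF := @ultra_proper _ _ UF.
have [|r [rd clr]] := @segment_compact R (- d) d (f x @[x --> F]) (fmap_proper_filter _ PF).
  have : F (f @^-1` `[- d, d]%classic) by apply: filterS Fd => y /=; rewrite ler_norml in_itv.
  by [].
exists r; first by move: rd; rewrite /= in_itv /= ler_norml.
move=> e e0; have [//|nF] := in_ultra_setVsetC [set y | `|r - f y| <= e] UF.
have /= := clr (f @` (~` [set y | `|r - f y| <= e])) (ball r e).
case=> [||_ [[y /= ny <-]]].
- by apply: filterS nF => y ny; exists y.
- exact: nbhsx_ballx.
- by rewrite -ball_normE /= => /ltW.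
Qed.

(** A Hilbert cube in the closed span of [g]; it will contain the image of the unit ball under a
    diagonal operator with geometrically decaying entries. *)
Definition diag_box (g : nat -> H) (d : R) : set H :=
  [set y | proj g y = y /\ forall k, `|complex.Re '[y, g k]| <= d * 2^-1 ^+ k /\
                                     `|complex.Im '[y, g k]| <= d * 2^-1 ^+ k].

(** Along an ultrafilter each coordinate converges, and the limits are square summable. Norm
    convergence follows by controlling finitely many coordinates directly and the tail by the size
    of the cube. *)
Lemma compact_diag_box (g : nat -> H) (d : R) : orthonormal_seq g -> 0 <= d ->
  compact (diag_box g d).
Proof.
move=> og d0; rewrite compact_ultra /= => F UF Fbox.
have PF := @ultra_proper _ _ UF.
have /choice[a aP] k : exists r : R, `|r| <= d * 2^-1 ^+ k /\ forall e : R, 0 < e ->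
    F [set y | `|r - complex.Re '[y, g k]| <= e].
  have [|r rd rF] := @ultra_segment _ F (fun y => complex.Re '[y, g k]) (d * 2^-1 ^+ k) UF.
    by apply: filterS Fbox => y [_ /(_ k)[]].
  by exists r.
have /choice[b bP] k : exists r : R, `|r| <= d * 2^-1 ^+ k /\ forall e : R, 0 < e ->
    F [set y | `|r - complex.Im '[y, g k]| <= e].
  have [|r rd rF] := @ultra_segment _ F (fun y => complex.Im '[y, g k]) (d * 2^-1 ^+ k) UF.
    by apply: filterS Fbox => y [_ /(_ k)[]].
  by exists r.
pose c k : C := Complex (a k) (b k).
have h1 k : 0 <= (2^-1 ^+ k : R) <= 1.
  by rewrite exprn_ge0 ?invr_ge0// exprn_ile1 ?invr_ge0// invf_le1// ler1n.
have sqle (r : R) k : `|r| <= d * 2^-1 ^+ k -> r ^+ 2 <= d ^+ 2 * 2^-1 ^+ k.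
  move=> rk; have /andP[h0 h01] := h1 k.
  have : `|r| ^+ 2 <= (d * 2^-1 ^+ k) ^+ 2.
    by rewrite ler_pXn2r ?nnegrE ?mulr_ge0.
  rewrite real_normK ?num_real// => /le_trans; apply.
  by rewrite exprMn ler_wpM2l ?sqr_ge0// expr2 ler_piMl.
have sqCle (z : C) k : `|complex.Re z| <= d * 2^-1 ^+ k ->
    `|complex.Im z| <= d * 2^-1 ^+ k -> sqC z <= 2 * d ^+ 2 * 2^-1 ^+ k.
  by move=> /sqle zr /sqle zi; rewrite /sqC; lra.
have cle k : sqC (c k) <= 2 * d ^+ 2 * 2^-1 ^+ k.
  by apply: sqCle; [case: (aP k)|case: (bP k)].
have [|y yP] := @riesz_fischer _ _ g c (2 * d ^+ 2 * (2 * 2^-1 ^+ 0)) og.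
  move=> n; apply: le_trans (ler_wpM2l _ (geom_tail R 0 n)); last by rewrite mulr_ge0 ?sqr_ge0.
  by rewrite mulr_sumr ler_sum.
have yc := lim_coef og yP.
exists y; split.
  split; first exact: proj_lim og _ _ yP.
  by move=> k; rewrite yc; split; [case: (aP k)|case: (bP k)].
rewrite /=; apply/(@cvgrPdist_le _ _ _ F _ id) => _ /gt0C[e e0 ->].
(* Beyond [N], each coordinate of a difference has square at most [8 d^2 2^-k], by [sqCD] applied to
   two points of the cube. Below [N], the tolerance [e / (4 (N+1))] contributes at most [e^2 / 8] in
   total. *)
have [N NP] : exists N, 8 * d ^+ 2 * (2 * 2^-1 ^+ N) <= e ^+ 2 / 2.
  have e1 : 0 < e ^+ 2 / 2 / (16 * d ^+ 2 + 1).
    by rewrite !divr_gt0 ?exprn_gt0// ltr_wpDl// mulr_ge0 ?sqr_ge0.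
  have [N hN] := harmonic_small e1; exists N.
  have : 2^-1 ^+ N <= (N.+1%:R)^-1 :> R.
    by rewrite exprVn lef_pV2 ?posrE ?exprn_gt0 ?ltr0n// -natrX ler_nat ltn_expl.
  move=> /le_trans/(_ (hN N (leqnn N))); rewrite ler_pdivlMr ?ltr_wpDl ?mulr_ge0 ?sqr_ge0//.
  by have /andP[p0 _] := h1 N; move: p0; set p := 2^-1 ^+ N; lra.
have e2 : 0 < e / (4 * N.+1%:R) by rewrite divr_gt0// mulr_gt0.
have FN : F [set z | forall k : 'I_N, `|a k - complex.Re '[z, g k]| <= e / (4 * N.+1%:R) /\
    `|b k - complex.Im '[z, g k]| <= e / (4 * N.+1%:R)].
  apply: filter_forall => k; apply: filterI; first by case: (aP k) => _; apply.
  by case: (bP k) => _; apply.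
have : F (diag_box g d `&` [set z | forall k : 'I_N,
    `|a k - complex.Re '[z, g k]| <= e / (4 * N.+1%:R) /\
    `|b k - complex.Im '[z, g k]| <= e / (4 * N.+1%:R)]) by exact: filterI.
apply: filterS => z [[Pz zd] zN] /=.
apply: (sqn_proj_le og (ltW e0)).
  have lP := proj_linear og.
  by rewrite (linB _ _ lP) Pz (proj_lim og yP).
move=> n; have bnd (k : 'I_n) : sqC '[y - z, g k] <=
    (if (N <= k)%N then 8 * d ^+ 2 * 2^-1 ^+ k else 0) +
    (if (k < N)%N then 2 * (e / (4 * N.+1%:R)) ^+ 2 else 0).
  rewrite ipBl yc; have [leNk|ltkN] := leqP N k.
    rewrite addr0; apply: le_trans (sqCD _ _) _.
    have -> : sqC (- '[z, g k]) = sqC '[z, g k].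
      by case: '[z, g k] => [? ?]; rewrite /sqC /= !sqrrN.
    have [zr zi] := zd k; have := cle k; have := sqCle _ _ zr zi.
    by set p := 2^-1 ^+ k; lra.
  rewrite add0r; have [/= zr zi] := zN (Ordinal ltkN).
  have zr2 : `|a k - complex.Re '[z, g k]| ^+ 2 <= (e / (4 * N.+1%:R)) ^+ 2.
    by rewrite ler_pXn2r ?nnegrE// ltW.
  have zi2 : `|b k - complex.Im '[z, g k]| ^+ 2 <= (e / (4 * N.+1%:R)) ^+ 2.
    by rewrite ler_pXn2r ?nnegrE// ltW.
  move: zr2 zi2; rewrite !real_normK ?num_real//.
  have -> : sqC (c k - '[z, g k]) = (a k - complex.Re '[z, g k]) ^+ 2 +
      (b k - complex.Im '[z, g k]) ^+ 2 by rewrite /sqC /c; case: '[z, g k].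
  by set q := (e / _) ^+ 2; lra.
apply: le_trans (ler_sum _ (fun k _ => bnd k)) _; rewrite big_split /=.
have -> : e ^+ 2 = e ^+ 2 / 2 + e ^+ 2 / 2 by field.
apply: lerD.
  apply: le_trans NP; apply: le_trans (ler_wpM2l _ (geom_tail R N n)); last first.
    by rewrite mulr_ge0 ?sqr_ge0.
  by rewrite mulr_sumr; apply: ler_sum => k _; case: ifP; rewrite ?mulr0.
have s0 : 0 <= 2 * (e / (4 * N.+1%:R)) ^+ 2 by rewrite mulr_ge0 ?sqr_ge0.
apply: le_trans (sum_head_le N n s0) _.
have sE (p r : R) : p != 0 ->
  r * (2 * (e / (4 * p)) ^+ 2) = e ^+ 2 / 8 * (r / p * p^-1) by move=> p0; field.
rewrite sE ?pnatr_eq0//.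
apply: (@le_trans _ _ (e ^+ 2 / 8 * 1)); last by have := sqr_ge0 e; lra.
rewrite ler_wpM2l ?divr_ge0 ?sqr_ge0// mulr_ile1 ?invr_ge0 ?divr_ge0//.
  by rewrite ler_pdivrMr// mul1r ler_nat.
by rewrite invf_le1// ler1n.
Qed.

Lemma compact_compression (g : nat -> H) A (d : nat -> C) (M : R) :
  orthonormal_seq g -> bounded_op A ->
  (forall j k, '[A (g j), g k] = if j == k then d j else 0) ->
  0 <= M -> (forall k, `|d k| <= (M * 2^-1 ^+ k)%:C) ->
  compact_op (proj g \o A \o proj g).
Proof.
move=> og bA Ad M0 dM; split.
  by apply: bounded_comp; [apply: bounded_comp => //|]; exact: proj_bounded.
have cK := compact_diag_box og M0.
have clK : closed (diag_box g M) by apply: compact_closed => //; exact: norm_hausdorff.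
rewrite precompactE; apply: (subclosed_compact _ cK); first exact: closed_closure.
rewrite closureE; apply: smallest_sub => // _ [x /= x1 <-].
have hx := compression_diag og bA Ad x.
split; first exact: (proj_lim og hx).
move=> k; rewrite (lim_coef og hx).
have : `|'[x, g k] * d k| <= (M * 2^-1 ^+ k)%:C.
  rewrite normrM -[X in _ <= X]mul1r ler_pM//.
  apply: le_trans (cauchy_schwarz _ _) _.
  have -> : `|g k| = 1.
    by apply/eqP; rewrite -(@eqrXn2 _ 2)// ?expr1n ?sqr_norm_hdot ?og ?eqxx.
  by rewrite mulr1.
set z := _ * _; rewrite normc_def lecR => zM.
have sq0 (r : R) : 0 <= r ^+ 2 by exact: sqr_ge0.
split; apply: le_trans zM; rewrite -sqrtr_sqr ler_wsqrtr//.
  by rewrite lerDl.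
by rewrite lerDr.
Qed.
End Compactness.

(** * Finite dimensional compressions *)

Section FiniteCase.
Context {R : realType} {H : hilbertType R}.
Local Notation C := R[i].
Implicit Types (x y z : H) (a b : C) (A B : H -> H) (X : set H) (g : nat -> H).
Variable V : set (H -> H).
Hypothesis systemV : operator_system V.
Notation sa_part := (sa_part V).

Lemma bounded_opDZ a A B : bounded_op A -> bounded_op B -> bounded_op (a *: A + B).
Proof.
move=> [lA [M AM]] [lB [N BN]]; split.
  move=> b x y; rewrite !fctE lA lB !scalerDr !scalerA mulrC -!addrA; congr (_ + _).
  by rewrite addrCA.
exists (`|a| * M + N) => x; apply: le_trans (ler_normD _ _) _.
rewrite mulrDl lerD// normrZ -mulrA ler_wpM2l//.
Qed.

Lemma bounded_op_sum n (c : nat -> C) (B : nat -> H -> H) :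
  (forall i, (i < n)%N -> bounded_op (B i)) ->
  bounded_op (\sum_(i < n) c i *: B i : H -> H).
Proof.
elim: n => [|n IH] bB.
  rewrite big_ord0; split; first by move=> a x y /=; rewrite scaler0 addr0.
  by exists 0 => x; rewrite normr0 mul0r.
rewrite big_ord_recr /= addrC; apply: bounded_opDZ; first exact: bB.
by apply: IH => i lti; apply: bB; rewrite ltnW.
Qed.

Lemma V_DZ a A B : V A -> V B -> V (a *: A + B).
Proof. by case: systemV => _ _ VD _; exact: VD. Qed.

Lemma V_id : V idfun. Proof. by case: systemV. Qed.

Lemma V_bounded A : V A -> bounded_op A.
Proof. by case: systemV => bV _ _ _; exact: bV. Qed.

Lemma V_sum n (c : nat -> C) (B : nat -> H -> H) : (forall i, (i < n)%N -> V (B i)) ->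
  V (\sum_(i < n) c i *: B i).
Proof.
elim: n => [|n IH] VB; first by rewrite big_ord0; case: (sa_part0 systemV).
rewrite big_ord_recr /= addrC; apply: V_DZ; first exact: VB.
by apply: IH => i lti; apply: VB; rewrite ltnW.
Qed.

(** The Cartesian decomposition: with [B] the adjoint of [A], the imaginary part [(A - B) / 2i] is
    written as [(i/2) (B - A)]. *)
Lemma self_adjoint_decomposition A : V A ->
  exists S T, [/\ sa_part S, sa_part T & A = S + Complex 0 1 *: T].
Proof.
move=> VA; have [B VB adjB] : exists2 B, V B & adjoint_of A B by case: systemV => _ _ _; apply.
have adjA : adjoint_of B A by move=> x y; rewrite ipC -adjB -ipC.
have V0 : V 0 by case: (sa_part0 systemV).
exists (2^-1 *: (A + B)), ((Complex 0 1 / 2) *: (B - A)); split.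
- split.
    rewrite -[_ *: _]addr0; apply: V_DZ => //.
    by rewrite -[A]scale1r; exact: V_DZ.
  move=> x y; rewrite -[(2^-1 *: _) x]/(2^-1 *: (A x + B x)).
  rewrite -[(2^-1 *: _) y]/(2^-1 *: (A y + B y)) ipZl ipZr ipDl ipDr adjA adjB.
  by rewrite fmorphV /= rmorph_nat addrC.
- split.
    rewrite -[_ *: _]addr0; apply: V_DZ => //.
    by rewrite addrC -scaleN1r; exact: V_DZ.
  move=> x y; rewrite -[(_ *: (B - A)) x]/((Complex 0 1 / 2) *: (B x - A x)).
  rewrite -[(_ *: (B - A)) y]/((Complex 0 1 / 2) *: (B y - A y)) ipZl ipZr ipBl ipBr adjA adjB.
  have -> : (Complex 0 1 / 2 : C)^* = - (Complex 0 1 / 2).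
    rewrite fmorph_div /= rmorph_nat -mulNr; congr (_ / _).
    by apply/eqP; rewrite eq_complex /= oppr0 !eqxx.
  by rewrite mulNr -mulrN opprB.
- apply/funext => x.
  rewrite -[RHS]/(2^-1 *: (A x + B x) + Complex 0 1 *: ((Complex 0 1 / 2) *: (B x - A x))).
  rewrite scalerA mulrA -[Complex 0 1 * _]expr2 sqr_i mulN1r scaleNr -scalerBr opprB.
  rewrite addrACA subrr addr0 -[in RHS](scale1r (A x)) -scalerDl scalerA.
  by rewrite (_ : 1 + 1 = 2)// mulVf ?scale1r// pnatr_eq0.
Qed.

Lemma tends_small n (B : nat -> H -> H) X (e : R) : 0 < e ->
  (forall i, (i < n)%N -> tends (B i) 0 X) ->
  exists Z : seq H, forall x, X x -> (forall z, z \in Z -> '[x, z] = 0) ->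
    forall i, (i < n)%N -> `|qform (B i) x| <= e * sqn x.
Proof.
move=> e0; elim: n => [|n IH] tB; first by exists [::].
have [|Z ZP] := IH; first by move=> i lti; apply: tB; rewrite ltnW.
have [Y YP] := tB n (ltnSn n) e e0; exists (Y ++ Z) => x Xx xZ i.
rewrite ltnS leq_eqVlt => /predU1P[->|lti].
  have := YP x Xx; rewrite mul0r subr0; apply => z zY.
  by apply: xZ; rewrite mem_cat zY.
by apply: ZP => // z zZ; apply: xZ; rewrite mem_cat zZ orbT.
Qed.

Lemma spanned_on_sub X Y n (B : nat -> H -> H) : Y `<=` X ->
  spanned_on V X n B -> spanned_on V Y n B.
Proof.
move=> YX [vB sB]; split=> // A /sB[t [c tc]]; exists t, c => x /YX; exact: tc.
Qed.

(** The decay [2^-k] is what makes the compressions of the [B i] compact. *)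
Definition diagonalized n (B : nat -> H -> H) g :=
  [/\ orthonormal_seq g, spanned_on V (span g) n B,
      forall i j k, (i < n)%N -> j != k -> '[B i (g j), g k] = 0 &
      forall i k, (i < n)%N -> `|qform (B i) (g k)| <= 2^-1 ^+ k].

(** Subtracting the essential values, which the identity absorbs, makes them all [0]; the next
    vector can then be chosen with form values as small as desired for all [B i] at once. *)
Lemma diagonalizing_basis n : finite_compression V n ->
  exists (B : nat -> H -> H) g, diagonalized n B g.
Proof.
move=> [X [B [bX [vB sB]]]].
have [|X' [l [bX' X'X tl]]] := @thin_family _ _ n B X bX.
  by move=> i /vB vBi; split; [exact: (sa_part_bounded systemV vBi)|case: vBi].
pose D i : H -> H := (- l i)%:C *: idfun + B i.
have vD i : (i < n)%N -> sa_part (D i).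
  by move=> lti; apply: (sa_partDZ systemV) => //; [exact: (sa_part_id systemV)|exact: vB].
have qD i x : qform (D i) x = qform (B i) x - l i * sqn x.
  by rewrite qformDZ qform_id; ring.
have tD i : (i < n)%N -> tends (D i) 0 X'.
  move=> lti e e0; have [Z ZP] := tl i lti e e0; exists Z => x Xx xZ.
  by rewrite qD mul0r subr0; exact: ZP.
have sD : spanned_on V X' n D.
  split=> // A /sB[t [c tc]]; exists (t + \sum_(i < n) c i * l i), c => x /X'X /tc ->.
  rewrite mulrDl -addrA; congr (_ + _); rewrite mulr_suml -big_split /=.
  by apply: eq_bigr => i _; rewrite qD; ring.
pose Q (h : seq H) x := [/\ X' x, '[x, x] = 1, forall z, z \in h -> '[x, z] = 0,
  forall i z, (i < n)%N -> z \in h -> '[x, D i z] = 0 &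
  forall i, (i < n)%N -> `|qform (D i) x| <= 2^-1 ^+ size h].
have [|g gQ] := @choose_hist H 0 Q.
  move=> h _; have e0 : 0 < 2^-1 ^+ size h :> R by rewrite exprn_gt0// invr_gt0.
  have [Z ZP] := tends_small e0 tD.
  have [_ /(_ (h ++ [seq D i z | i <- iota 0 n, z <- h] ++ Z))[x Xx [nx xZ]]] := bX'.
  exists x; split=> //.
  - by move=> z zh; apply: xZ; rewrite mem_cat zh.
  - move=> i z lti zh; apply: xZ; rewrite !mem_cat allpairs_f ?orbT//.
    by rewrite mem_iota.
  - have sx : sqn x = 1 by rewrite /sqn nx.
    have := ZP x Xx; rewrite sx mulr1; apply => z zZ.
    by apply: xZ; rewrite !mem_cat zZ !orbT.
have gh j k : (j < k)%N -> g j \in mkseq g k.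
  by move=> jk; apply/mapP; exists j; rewrite ?mem_iota.
have og : orthonormal_seq g.
  apply: orthonormal_seqP => [k|j k jk]; first by case: (gQ k).
  by case: (gQ k) => _ _ h _ _; apply: h; exact: gh.
exists D, g; split=> //.
- apply: spanned_on_sub sD; apply: span_sub; first by case: bX'.
  by move=> k; case: (gQ k).
- move=> i j k lti; case: ltngtP => // [jk|kj] _.
    by apply: ip_orthC; case: (gQ k) => _ _ _ h _; apply: h => //; exact: gh.
  have [_ sDi] := vD i lti; rewrite sDi.
  by case: (gQ j) => _ _ _ h _; apply: h => //; exact: gh.
- by move=> i k lti; case: (gQ k) => _ _ _ _; rewrite size_mkseq; apply.
Qed.

Lemma ip_op_sumC n (c : nat -> C) (B : nat -> H -> H) x y :
  '[(\sum_(i < n) c i *: B i) x, y] = \sum_(i < n) c i * '[B i x, y].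
Proof.
by rewrite fct_sumE ip_suml; apply: eq_bigr => i _; rewrite ipZl.
Qed.

Lemma ip_residual n A a (c : nat -> C) (B : nat -> H -> H) x y :
  '[(A - a *: idfun - \sum_(i < n) c i *: B i) x, y] =
  '[A x, y] - a * '[x, y] - \sum_(i < n) c i * '[B i x, y].
Proof.
rewrite -ip_op_sumC -ipZl -!ipBl; congr ('[_, _]).
Qed.

Lemma compression0 g A : orthonormal_seq g -> bounded_op A ->
  (forall j k, '[A (g j), g k] = 0) -> forall x, proj g (A (proj g x)) = 0.
Proof.
move=> og bA A0 x; have h j k : '[A (g j), g k] = if j == k then 0 else 0.
  by rewrite A0 if_same.
apply: (lim_unique (compression_diag og bA h x)).
apply: (@lim_eventually _ _ _ _ 0%N) => n _.
by rewrite /psum big1// => k _; rewrite mulr0 scale0r.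
Qed.

Section Diagonalized.
Variables (n : nat) (B : nat -> H -> H) (g : nat -> H).
Hypothesis dB : diagonalized n B g.

Let og : orthonormal_seq g. Proof. by case: dB. Qed.
Let vB i : (i < n)%N -> sa_part (B i).
Proof. by case: dB => _ [vB _] _ _; exact: vB. Qed.

(** For self-adjoint operators the residual has zero form on the span, so [polarization] kills its
    entries; the Cartesian decomposition then yields complex coefficients. *)
Lemma diagonalized_matrix A : V A -> exists a (c : nat -> C), forall j k,
  '[(A - a *: idfun - \sum_(i < n) c i *: B i) (g j), g k] = 0.
Proof.
have saP S : sa_part S -> exists (t : R) (c : nat -> R), forall j k,
    '[(S - t%:C *: idfun - \sum_(i < n) (c i)%:C *: B i) (g j), g k] = 0.
  move=> vS; case: dB => _ [_ sB] _ _; have [t [c tc]] := sB S vS; exists t, c => j k.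
  set D := (X in '[X _, _]).
  have vD : sa_part D.
    have -> : D = (-1)%:C *: (\sum_(i < n) (c i)%:C *: B i) + ((- t)%:C *: idfun + S).
      rewrite /D rmorphN rmorph1 scaleN1r rmorphN scaleNr addrC.
      by rewrite [X in _ + X]addrC.
    apply: (sa_partDZ systemV) => //; first exact: (sa_part_sum systemV).
    by apply: (sa_partDZ systemV) => //; exact: (sa_part_id systemV).
  apply: (@polarization _ _ (span g)); first exact: subspace_span.
  - exact: (sa_part_linear systemV vD).
  - by case: vD.
  - move=> x gx; rewrite /D /qform /= !ipBl !(ReD, ReN).
    have := qform_sum n c B x; rewrite /qform => ->.
    by rewrite -[(_ *: idfun) x]/(t%:C *: x) ipZl ReRM -/(sqn x) -/(qform S x) tc//; ring.
  - exact: span_gen.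
  - exact: span_gen.
move=> /self_adjoint_decomposition[S [T [vS vT ->]]].
have [s [c sc]] := saP S vS; have [t [d td]] := saP T vT.
exists (s%:C + Complex 0 1 * t%:C), (fun i => (c i)%:C + Complex 0 1 * (d i)%:C) => j k.
have hS : '[S (g j), g k] =
    s%:C * '[g j, g k] + \sum_(i < n) (c i)%:C * '[B i (g j), g k].
  apply/eqP; rewrite -subr_eq0 opprD addrA.
  by rewrite -(ip_residual _ _ _ (fun i => (c i)%:C)) sc.
have hT : '[T (g j), g k] =
    t%:C * '[g j, g k] + \sum_(i < n) (d i)%:C * '[B i (g j), g k].
  apply/eqP; rewrite -subr_eq0 opprD addrA.
  by rewrite -(ip_residual _ _ _ (fun i => (d i)%:C)) td.
rewrite (ip_residual _ _ _ (fun i => (c i)%:C + Complex 0 1 * (d i)%:C)).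
rewrite -[(S + _) (g j)]/(S (g j) + Complex 0 1 *: T (g j)) ipDl ipZl hS hT.
under [X in _ - X]eq_bigr do rewrite mulrDl -mulrA.
by rewrite big_split /= -mulr_sumr; ring.
Qed.

Lemma span_compression A : V A -> exists a (c : nat -> C),
  proj g \o A \o proj g = a *: proj g + \sum_(i < n) c i *: (proj g \o B i \o proj g).
Proof.
move=> VA; have [a [c ac]] := diagonalized_matrix VA; exists a, c.
have bD : bounded_op (A - a *: idfun - \sum_(i < n) c i *: B i).
  have -> : A - a *: idfun - \sum_(i < n) c i *: B i =
      (-1) *: (\sum_(i < n) c i *: B i) + ((- a) *: idfun + A).
    by rewrite scaleN1r scaleNr addrC [X in _ + X]addrC.
  apply: bounded_opDZ.
    by apply: bounded_op_sum => i lti; apply: (sa_part_bounded systemV (vB lti)).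
  by apply: bounded_opDZ; [exact: (V_bounded V_id)|exact: (V_bounded VA)].
have lP := proj_linear og.
apply/funext => x; have /eqP := compression0 og bD ac x.
rewrite -[(A - _ - _) _]/(A (proj g x) - a *: proj g x -
  (\sum_(i < n) c i *: B i) (proj g x)).
rewrite !(linB _ _ lP) (linZ _ _ lP) proj_proj// subr_eq0 subr_eq => /eqP /= ->.
rewrite addrC -[RHS]/(a *: proj g x + (\sum_(i < n) c i *: (proj g \o B i \o proj g)) x).
congr (_ + _); rewrite !fct_sumE (lin_sum _ _ _ lP).
by apply: eq_bigr => i _; rewrite (linZ _ _ lP).
Qed.

Lemma combination_in_compression a (c : nat -> C) :
  compression (proj g) V
    (a *: proj g + \sum_(i < n) c i *: (proj g \o B i \o proj g)).
Proof.
have lP := proj_linear og.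
exists (a *: idfun + \sum_(i < n) c i *: B i).
  apply: V_DZ; first exact: V_id.
  by apply: V_sum => i lti; case: (vB lti).
apply/funext => x; rewrite /= -[(a *: idfun + _) _]/(a *: proj g x +
  (\sum_(i < n) c i *: B i) (proj g x)).
rewrite linD// (linZ _ _ lP) proj_proj//.
rewrite -[RHS]/(a *: proj g x + (\sum_(i < n) c i *: (proj g \o B i \o proj g)) x).
congr (_ + _); rewrite !fct_sumE (lin_sum _ _ _ lP).
by apply: eq_bigr => i _; rewrite (linZ _ _ lP).
Qed.

Lemma finite_dim_compression : finite_dim (compression (proj g) V).
Proof.
exists (proj g :: mkseq (fun i => proj g \o B i \o proj g) n).
have sE (c : nat -> C) :
    \sum_(i < size (proj g :: mkseq (fun i => proj g \o B i \o proj g) n))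
      c i *: (proj g :: mkseq (fun i => proj g \o B i \o proj g) n)`_i =
    c 0 *: proj g + \sum_(i < n) c i.+1 *: (proj g \o B i \o proj g).
  rewrite /= size_mkseq big_ord_recl /=; congr (_ + _); apply: eq_bigr => i _.
  rewrite -[LHS]/(c i.+1 *: (mkseq (fun k => proj g \o B k \o proj g) n)`_i).
  by rewrite nth_mkseq.
rewrite predeqE => A; split.
  move=> [D VD <-]; have [a [c ->]] := span_compression VD; apply/lin_spanP.
  pose phi k := if k is k'.+1 then c k' else a.
  by exists phi; rewrite (sE phi).
move=> /lin_spanP[c ->]; rewrite sE.
exact: (combination_in_compression (c 0%N) (fun i => c i.+1)).
Qed.

(** After removing the scalar, the diagonal entries are combinations of those of the [B i], hence at
    most [sum |c i|] times [2^-k]. *)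
Lemma scalar_plus_compact A : compression (proj g) V A ->
  exists a K, compact_op K /\ A = a *: proj g + K.
Proof.
move=> [D VD <-]; have [a [c ac]] := diagonalized_matrix VD.
have bE : bounded_op (- a *: idfun + D).
  by apply: bounded_opDZ; [exact: (V_bounded V_id)|exact: (V_bounded VD)].
exists a, (proj g \o (- a *: idfun + D) \o proj g); split; last first.
  have lP := proj_linear og; apply/funext => x.
  rewrite -[RHS]/(a *: proj g x + proj g (- a *: proj g x + D (proj g x))).
  by rewrite (linD _ _ lP) (linZ _ _ lP) proj_proj// addrA scaleNr subrr add0r.
pose d k := \sum_(i < n) c i * '[B i (g k), g k].
apply: (@compact_compression _ _ g _ d (\sum_(i < n) complex.Re `|c i|)) => //.
- move=> j k; have /eqP := ac j k; rewrite ip_residual subr_eq0 => /eqP e.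
  rewrite -[(_ + D) _]/(- a *: g j + D (g j)) addrC scaleNr ipBl ipZl e.
  case: eqVneq => [<- //|jk]; apply: big1 => i _.
  by case: dB => _ _ h _; rewrite h ?mulr0.
- by apply: sumr_ge0 => i _; rewrite -ler0c RRe_real ?normr_real.
move=> k; apply: le_trans (ler_norm_sum _ _ _) _.
rewrite rmorphM rmorph_sum mulr_suml; apply: ler_sum => i _.
rewrite -[leRHS]/((complex.Re `|c i|)%:C * (2^-1 ^+ k)%:C).
rewrite RRe_real ?normr_real// normrM ler_wpM2l//.
have vBi := vB (ltn_ord i); rewrite qformE; last by case: vBi.
rewrite normc_def lecR /= expr0n addr0 sqrtr_sqr.
by case: dB => _ _ _; apply.
Qed.

End Diagonalized.

Lemma anticlique_of_scalars (B : nat -> H -> H) g : diagonalized 0 B g ->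
  infinite_quantum_anticlique V (proj g).
Proof.
move=> dB; have [og _ _ _] := dB; split.
- exact: projection_proj.
- exact: proj_infinite_rank.
rewrite predeqE => A; split=> [[D VD <-]|[a _ <-]].
  have [a [c ->]] := span_compression dB VD.
  by exists a => //; rewrite big_ord0 addr0.
have := combination_in_compression dB a (fun=> 0).
by rewrite big_ord0 addr0.
Qed.

(** A diagonal operator without zero entries has every [g k] in its range: Fourier partial sums have
    preimages with coefficients divided by the entries, which gives density. *)
Lemma obstruction_of_nonvanishing n (B : nat -> H -> H) g : diagonalized n.+1 B g ->
  (forall k, qform (B 0%N) (g k) != 0) ->
  infinite_quantum_obstruction V (proj g).
Proof.
move=> dB nz; have [og [vB _] oB qB] := dB.
have lP := proj_linear og; have sP := proj_sa og.
have vB0 : sa_part (B 0%N) by exact: vB.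
have bB0 := sa_part_bounded systemV vB0; have [VB0 sB0] := vB0.
have BE j k : '[B 0%N (g j), g k] = if j == k then (qform (B 0%N) (g j))%:C else 0.
  by case: eqVneq => [<-|jk]; [rewrite qformE|rewrite oB].
split.
- exact: projection_proj.
- exact: proj_infinite_rank.
- exact: finite_dim_compression dB.
- exact: scalar_plus_compact dB.
pose T := proj g \o B 0%N \o proj g; exists T; split.
- by exists (B 0%N).
- by move=> x y; rewrite /T /= sP sB0 -sP.
- apply: (@compact_compression _ _ g _ (fun k => (qform (B 0%N) (g k))%:C) 1) => // k.
  by rewrite mul1r normc_def lecR /= expr0n addr0 sqrtr_sqr qB.
have lT : linear T by move=> a x y; rewrite /T /= lP (sa_part_linear systemV vB0) lP.
have Tg k : T (g k) = (qform (B 0%N) (g k))%:C *: g k.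
  rewrite /T /= proj_gen//; apply: lim_unique (proj_cvg og _) _.
  apply: (@lim_eventually _ _ _ _ k.+1) => m km.
  rewrite /psum (bigD1 (Ordinal km))//= BE eqxx big1 ?addr0// => j jk.
  by rewrite BE eq_sym (negbTE (jk : (nat_of_ord j != k))) scale0r.
move=> _ [x _ <-] N /(proj_cvg og x)[m _ /(_ m (leqnn m)) Nm].
exists (psum g (fun k => '[x, g k]) m); split=> //.
exists (psum g (fun k => '[x, g k] / (qform (B 0%N) (g k))%:C) m) => //.
rewrite /psum (lin_sum _ _ _ lT); apply: eq_bigr => k _.
rewrite (linZ _ _ lT) Tg scalerA divfK// -[0]/(0%:C) (inj_eq (@complexI R)).
exact: nz.
Qed.

Lemma diagonalized_reindex n (B : nat -> H -> H) g (phi : nat -> nat) : diagonalized n B g ->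
  (forall j k, (j < k)%N -> (phi j < phi k)%N) ->
  [/\ orthonormal_seq (g \o phi), span (g \o phi) `<=` span g &
    diagonalized n B (g \o phi)].
Proof.
move=> [og sB oB qB] phiS.
have phi_eq j k : (phi j == phi k) = (j == k).
  case: (ltngtP j k) => [/phiS|/phiS|->]; last by rewrite eqxx.
    by move=> h; rewrite ltn_eqF.
  by move=> h; rewrite gtn_eqF.
have oh : orthonormal_seq (g \o phi) by move=> j k /=; rewrite og phi_eq.
have ss : span (g \o phi) `<=` span g.
  by apply: span_sub; [exact: subspace_span|move=> k; exact: span_gen].
split=> //; split=> //.
- exact: spanned_on_sub sB.
- by move=> i j k lti jk /=; apply: oB => //; rewrite phi_eq.
- move=> i k lti; apply: le_trans (qB _ _ lti) _ => /=.
  (* A strictly increasing [phi] satisfies [k <= phi k], so the decay survives thinning. *)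
  have le_phi : (k <= phi k)%N by elim: k => // k IH; apply: leq_ltn_trans IH (phiS _ _ _).
  by rewrite ler_wiXn2l// ?invr_ge0// invf_le1// ler1n.
Qed.

(* If the first diagonal had infinitely many zeros, restricting to these indices
   would contradict the minimality of [n]. *)
Lemma anticlique_or_obstruction n : finite_compression V n ->
  (exists P, infinite_quantum_anticlique V P) \/
  (exists P, infinite_quantum_obstruction V P).
Proof.
move=> fcn; have exn : exists n, `[< finite_compression V n >].
  by exists n; exact/asboolP.
case: (ex_minnP exn) => {n fcn exn} -[|n] /asboolP fcn nmin.
  left; have [B [g dB]] := diagonalizing_basis fcn.
  by exists (proj g); exact: anticlique_of_scalars dB.
right; have [B [g dB]] := diagonalizing_basis fcn.
have [[K nz]|nK] := pselect (exists K, forall k, (K <= k)%N -> qform (B 0%N) (g k) != 0).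
  have [|_ _ dh] := @diagonalized_reindex _ B g (addn K) dB.
    by move=> j k; rewrite ltn_add2l.
  exists (proj (g \o addn K)); apply: (obstruction_of_nonvanishing dh) => k /=.
  by apply: nz; rewrite leq_addr.
exfalso; pose Q (h : seq nat) k :=
  (forall j, j \in h -> (j < k)%N) /\ qform (B 0%N) (g k) = 0.
have [|phi phiQ] := @choose_hist nat 0%N Q.
  move=> h _; apply: contrapT => nq; apply: nK.
  exists (\max_(j <- h) j).+1 => k hk; apply/eqP => qk; apply: nq; exists k; split=> // j jh.
  by apply: leq_trans hk; rewrite ltnS; exact: leq_bigmax_seq.
have phiS j k : (j < k)%N -> (phi j < phi k)%N.
  move=> jk; case: (phiQ k) => + _; apply; apply/mapP; exists j => //.
  by rewrite mem_iota.
have [oh _ [_ [vB sB] oB _]] := diagonalized_reindex dB phiS.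
have : `[< finite_compression V n >].
  apply/asboolP; exists (span (g \o phi)), (fun i => B i.+1); split; first exact: big_span.
  split; first by move=> i lti; exact: vB.
  move=> A /sB[t [c tc]]; exists t, (fun i => c i.+1) => x gx.
  rewrite tc// big_ord_recl /=; congr (_ + _).
  suff -> : qform (B 0%N) x = 0 by rewrite mulr0 add0r.
  have [m /(_ m (leqnn m)) xE] := gx; pose e k := '[x, (g \o phi) k].
  rewrite /qform {1 2}xE (@diag_form _ _ _ _ _ e e)//.
  - rewrite Re_sum big1// => k _; rewrite -normCK normC_sqr ReRM.
    by case: (phiQ k) => _; rewrite /qform /= => ->; rewrite mulr0.
  - by apply: (sa_part_linear systemV); exact: vB.
  - by move=> j k jk; exact: oB.
by move=> /nmin; rewrite ltnn.
Qed.

End FiniteCase.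

(** * Cliques *)

Section Frame.
Context {R : realType} {H : hilbertType R}.
Local Notation C := R[i].
Implicit Types (x y : H) (a b : C) (A B : H -> H).

(** Sums over the fourth roots of unity cancel all but one term, both for orthogonality of the frame
    and for polarization. *)
Lemma sum_ipow : \sum_(z < 4) (Complex 0 1 : C) ^+ z = 0.
Proof.
rewrite !big_ord_recl big_ord0 /= !exprS !expr0; apply/eqP.
by rewrite eq_complex /=; apply/andP; split; apply/eqP; ring.
Qed.

Lemma sum_ipow_conj : \sum_(z < 4) ((Complex 0 1 : C) ^+ z)^* = 0.
Proof. by rewrite -rmorph_sum sum_ipow rmorph0. Qed.

Lemma ipow_conj (z : nat) : (Complex 0 1 : C) ^+ z * (Complex 0 1 ^+ z)^* = 1.
Proof.
rewrite -normCK normrX (_ : `|Complex 0 1 : C| = 1) ?expr1n//.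
by rewrite normc_def /= expr0n expr1n add0r sqrtr1.
Qed.

Lemma sum_ipow_conj2 : \sum_(z < 4) ((Complex 0 1 : C) ^+ z)^* ^+ 2 = 0.
Proof.
under eq_bigr do rewrite -rmorphXn -exprM; rewrite -rmorph_sum.
rewrite (_ : \sum_(z < 4) _ = 0) ?rmorph0// !big_ord_recl big_ord0 /=.
rewrite !exprS !expr0; apply/eqP.
by rewrite eq_complex /=; apply/andP; split; apply/eqP; ring.
Qed.

(* [g m] overlaps, in coordinates [f], with every other [g l] along the four
   vectors indexed by [(m, l, z)], so that the projections of the [f k] contain,
   up to scalars, all [s g_j + i^z t g_l]: enough for polarization. *)
Lemma frame_sequence (f : nat -> H) : orthonormal_seq f ->
  exists g, [/\ orthonormal_seq g, forall m, proj f (g m) = g m &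
    forall j l, exists s t : C, [/\ s != 0, t != 0 & forall z : 'I_4,
      exists k, proj g (f k) = s *: g j + (Complex 0 1 ^+ z * t) *: g l]].
Proof.
move=> of_; pose F (j l : nat) (z : 'I_4) := f (pickle (j, l, z)).
have FE j l z j' l' z' : '[F j l z, F j' l' z'] =
    ((j == j') && (l == l') && (z == z'))%:R.
  by rewrite of_ (inj_eq (pcan_inj pickleK)) -!pair_eqE.
(* With [rho ^+ 2 = 1/2], the squares of the weights [r l] sum to [1], and [kap ^+ 2 = 1/8]
   normalizes [h m l]: its squared norm before scaling is [8], also for [l = m], where the two
   summands coincide up to phase. *)
pose rho : R := Num.sqrt 2^-1.
have rho0 : 0 < rho by rewrite sqrtr_gt0 invr_gt0.
have rho2 : rho ^+ 2 = 2^-1 by rewrite sqr_sqrtr// invr_ge0.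
pose r l : C := (rho ^+ l.+1)%:C; pose kap : C := (rho ^+ 3)%:C.
have rC l : (r l)^* = r l by exact: conjR.
have kC : kap^* = kap by exact: conjR.
have k8 : kap ^+ 2 * 8 = 1.
  have e8 : (rho ^+ 3) ^+ 2 * 8 = 1 by rewrite -exprM mulnC exprM rho2; field.
  by have := congr1 (real_complex R) e8; rewrite rmorphM rmorphXn rmorph_nat rmorph1.
have r0 l : r l != 0 by rewrite -[0]/(0%:C) (inj_eq (@complexI R)) gt_eqF// exprn_gt0.
have kap0 : kap != 0 by rewrite -[0]/(0%:C) (inj_eq (@complexI R)) gt_eqF// exprn_gt0.
(* [h m l] and [h l m] use the same basis vectors; for [m != l] the phases cancel their inner
   product over the four values of [z]. *)
pose h m l : H := \sum_(z < 4) kap *: (F m l z + ((Complex 0 1 : C) ^+ z)^* *: F l m z).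
have hF m l j l' z : '[h m l, F j l' z] =
    kap * ((m == j) && (l == l'))%:R
    + kap * ((Complex 0 1 : C) ^+ z)^* * ((l == j) && (m == l'))%:R.
  rewrite /h ip_suml (bigD1 z)//= big1 ?addr0 => [|z' z'z].
    by rewrite ipZl ipDl ipZl !FE eqxx !andbT; ring.
  by rewrite ipZl ipDl ipZl !FE (negbTE z'z) !andbF mulr0 addr0 mulr0.
have sum4 (t : 'I_4 -> C) a b : (forall z : 'I_4, t z = a + b * (Complex 0 1 : C) ^+ z +
    b * ((Complex 0 1 : C) ^+ z)^*) -> \sum_z t z = 4 * a.
  move=> tE; rewrite (eq_bigr _ (fun z _ => tE z)) !big_split /=.
  rewrite -!mulr_sumr sum_ipow sum_ipow_conj !mulr0 !addr0.
  by rewrite sumr_const card_ord mulr_natl.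
have oh m : orthonormal_seq (h m).
  move=> l l'; rewrite {2}/h ip_sumr.
  rewrite (sum4 _ (kap ^+ 2 * ((l == l')%:R * 2))
    (kap ^+ 2 * ((l == m) && (m == l'))%:R)); last first.
    move=> z; rewrite ipZr ipDr ipZr conjCK kC !hF !eqxx andbT /=.
    rewrite [(m == l') && (l == m)]andbC; have zz := ipow_conj z; ring: zz.
  by transitivity (kap ^+ 2 * 8 * (l == l')%:R); [ring|rewrite k8 mul1r].
have sr n : \sum_(l < n) sqC (r l) <= 1.
  have le2 : \sum_(l < n) 2^-1 ^+ l <= 2 * 2^-1 ^+ 0 :> R := geom_tail R 0 n.
  have -> : \sum_(l < n) sqC (r l) = 2^-1 * \sum_(l < n) 2^-1 ^+ l.
    rewrite mulr_sumr; apply: eq_bigr => l _.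
    by rewrite /sqC /= expr0n addr0 -exprM mulnC exprM rho2 exprS.
  by move: le2; rewrite expr0; lra.
have /choice[g gP] m : exists y, psum (h m) r n @[n --> \oo] --> y.
  exact: riesz_fischer (oh m) sr.
(* Conjugated, these are the coordinates along [g] of the projected basis vector: [kap * r l] on
   [g j] and [i^z * kap * r j] on [g l]. *)
have gF m j l z : '[g m, F j l z] = kap * ((m == j)%:R * r l) +
    kap * ((Complex 0 1 : C) ^+ z)^* * ((m == l)%:R * r j).
  apply: (@lim_unique _ C^o _ _ _ (lim_ipl _ (gP m))).
  apply: (@lim_eventually _ C^o _ _ (maxn j l).+1) => n; rewrite gtn_max => /andP[jn ln].
  rewrite /psum ip_suml; under eq_bigr do rewrite ipZl hF mulrDr.
  rewrite big_split /=; congr (_ + _).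
    rewrite (bigD1 (Ordinal ln))//= eqxx andbT big1 ?addr0 => [|k kl]; first by ring.
    by rewrite (negbTE (kl : (nat_of_ord k != l))) andbF !mulr0.
  rewrite (bigD1 (Ordinal jn))//= eqxx big1 ?addr0 => [|k kj]; first by rewrite /=; ring.
  by rewrite (negbTE (kj : (nat_of_ord k != j))) !mulr0.
have gh m' m l : '[g m', h m l] = (m' == m)%:R * r l.
  rewrite /h ip_sumr;
  rewrite (sum4 _ (kap ^+ 2 * ((m' == m)%:R * r l * 2))
    (kap ^+ 2 * ((m' == l)%:R * r m))); last first.
    move=> z; rewrite ipZr ipDr ipZr conjCK kC !gF.
    by have zz := ipow_conj z; ring: zz.
  by transitivity (kap ^+ 2 * 8 * ((m' == m)%:R * r l)); [ring|rewrite k8 mul1r].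
have rsum n : \sum_(l < n) r l * r l = 1 - (2^-1 ^+ n : R)%:C.
  elim: n => [|n IH]; first by rewrite big_ord0 expr0 rmorph1 subrr.
  rewrite big_ord_recr /= IH -rmorphM -exprD addnn -muln2 mulnC exprM rho2 exprS.
  rewrite [in RHS]rmorphM fmorphV rmorph_nat.
  by rewrite -[LHS]addrA; congr (_ + _); field.
have og : orthonormal_seq g.
  move=> m' m; apply: (@lim_unique _ C^o _ _ _ (lim_ipr _ (gP m))).
  have -> : (fun n => '[g m', psum (h m) r n]) =
      (fun n => (m' == m)%:R - (m' == m)%:R * (2^-1 ^+ n : R)%:C).
    apply/funext => n; rewrite /psum ip_sumr; under eq_bigr do rewrite ipZr rC gh mulrCA.
    by rewrite -mulr_sumr rsum mulrBr mulr1.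
  apply/(@limP _ C^o) => e e0; have [N NP] := harmonic_small e0; exists N => n Nn.
  rewrite opprB addrCA subrr addr0 normrM.
  apply: (@le_trans _ _ (2^-1 ^+ n : R)%:C).
    rewrite -[X in _ <= X]mul1r ler_pM//; first by case: eqP; rewrite ?normr1 ?normr0.
    by rewrite ger0_norm// ler0c exprn_ge0// invr_ge0.
  rewrite lecR (le_trans _ (NP n Nn))// exprVn lef_pV2 ?posrE ?exprn_gt0 ?ltr0n//.
  by rewrite -natrX ler_nat ltn_expl.
exists g; split=> //.
  move=> m; have lP := proj_linear of_.
  apply: (lim_unique (lim_bounded_op (proj_bounded of_) (gP m))).
  apply: eq_lim (gP m) => n; rewrite /psum (lin_sum _ _ _ lP); apply: eq_bigr => l _.
  rewrite (linZ _ _ lP) /h (lin_sum _ _ _ lP); congr (_ *: _); apply: eq_bigr => z _.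
  by rewrite (linZ _ _ lP) (linD _ _ lP) (linZ _ _ lP) !proj_gen.
move=> j l; exists (kap * r l), (kap * r j); split; [by rewrite mulf_neq0..|].
move=> z; exists (pickle (j, l, z)); have lP := proj_linear og.
set v := RHS; have <- : proj g v = v by rewrite /v (linD _ _ lP) !(linZ _ _ lP) !proj_gen.
apply/eqP; rewrite -subr_eq0 -(linB _ _ lP); apply/eqP; apply: (proj_eq0 og) => m.
rewrite ipBl [X in X - _]ipC gF /v ipDl !ipZl !og !rmorphD !rmorphM /=.
rewrite conjCK !kC !rC !rmorph_nat ![_ == m]eq_sym; ring.
Qed.

End Frame.

(** * Finite rank functionals and weak density *)

Section Clique.
Context {R : realType} {H : hilbertType R}.
Local Notation C := R[i].
Implicit Types (x y : H) (a b : C) (A B T : H -> H).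

(** The value of the functional [T |-> sum c_i <T u_i, w_i>] at the rank one operator
    [v |-> <v, x> y]. *)
Definition finite_rank_coef p (c : 'I_p -> C) (u w : 'I_p -> H) x y : C :=
  \sum_i c i * '[u i, x] * '[y, w i].

Lemma lim_lincomb (I : finType) (c : I -> C) (v : I -> nat -> C) (m : I -> C) :
  (forall i, v i n @[n --> \oo] --> (m i : C^o)) ->
  (\sum_i c i * v i n) @[n --> \oo] --> (\sum_i c i * m i : C^o).
Proof.
move=> vm; elim: (index_enum I) => [|i r IH].
  by rewrite big_nil; apply: (@lim_eventually _ C^o _ _ 0%N) => n _; rewrite big_nil.
rewrite big_cons; have h := @limDZ _ C^o (c i) (v i) _ (m i) _ (vm i) IH.
by refine (@eq_lim _ C^o _ _ _ _ h); move=> n; rewrite big_cons.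
Qed.

(** Expanding the [u i] along [g] rewrites the functional as a series of terms [<T (g k), y k>].
    Each [y k] lies in the closed span and is orthogonal to every [g l], hence is zero. *)
Lemma finite_rank_annihilator p (c : 'I_p -> C) (u w : 'I_p -> H) (g : nat -> H) T :
  orthonormal_seq g -> (forall i, proj g (u i) = u i) -> (forall i, proj g (w i) = w i) ->
  (forall j l, finite_rank_coef c u w (g j) (g l) = 0) -> bounded_op T ->
  \sum_i c i * '[T (u i), w i] = 0.
Proof.
move=> og gu gw b0 bT; have lP := proj_linear og.
pose y j := \sum_i (c i * '[u i, g j])^* *: w i.
have y0 j : y j = 0.
  have Py : proj g (y j) = y j.
    rewrite /y (lin_sum _ _ _ lP); apply: eq_bigr => i _.
    by rewrite (linZ _ _ lP) gw.
  rewrite -Py; apply: (proj_eq0 og) => l; apply: ip_orthC.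
  rewrite -[RHS](b0 j l) /y ip_sumr; apply: eq_bigr => i _.
  by rewrite ipZr conjCK.
have psumE n : \sum_i c i * '[psum (T \o g) (fun k => '[u i, g k]) n, w i] = 0.
  under eq_bigr do rewrite /psum ip_suml mulr_sumr.
  rewrite exchange_big big1// => k _ /=.
  transitivity ('[T (g k), y k]); last by rewrite y0 ip0r.
  rewrite /y ip_sumr; apply: eq_bigr => i _.
  by rewrite ipZl ipZr conjCK mulrA.
have limE : (fun n => \sum_i c i * '[psum (T \o g) (fun k => '[u i, g k]) n, w i])
    n @[n --> \oo] --> (\sum_i c i * '[T (proj g (u i)), w i] : C^o).
  apply: lim_lincomb => i; exact: lim_ipl (lim_op_proj og T (u i) bT).
under eq_bigr do rewrite -gu.
apply: (@lim_unique _ C^o _ _ _ limE).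
by apply: (@lim_eventually _ C^o _ _ 0%N) => n _; exact: psumE.
Qed.

(** The coefficient is conjugate-linear in [x] and linear in [y]. Weighting by the conjugate of
    [i^z] and summing over [z] leaves four times [s^* t] times the wanted value. *)
Lemma coef_polarization p (c : 'I_p -> C) (u w : 'I_p -> H) x y (s t : C) :
  s != 0 -> t != 0 ->
  (forall z : 'I_4, finite_rank_coef c u w (s *: x + (Complex 0 1 ^+ z * t) *: y)
     (s *: x + (Complex 0 1 ^+ z * t) *: y) = 0) ->
  finite_rank_coef c u w x y = 0.
Proof.
move=> s0 t0 h.
pose b x y := finite_rank_coef c u w x y.
have bE (r : C) : b (s *: x + r *: y) (s *: x + r *: y) =
    s^* * s * b x x + s^* * r * b x y + r^* * s * b y x + r^* * r * b y y.
  rewrite /b /finite_rank_coef !mulr_sumr -!big_split /=; apply: eq_bigr => i _.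
  by rewrite !(ipDl, ipDr, ipZl, ipZr); ring.
have : \sum_(z < 4) ((Complex 0 1 : C) ^+ z)^* *
    b (s *: x + (Complex 0 1 ^+ z * t) *: y) (s *: x + (Complex 0 1 ^+ z * t) *: y) = 0.
  by apply: big1 => z _; rewrite /b h mulr0.
have sE (z : 'I_4) : ((Complex 0 1 : C) ^+ z)^* *
    b (s *: x + (Complex 0 1 ^+ z * t) *: y) (s *: x + (Complex 0 1 ^+ z * t) *: y) =
    s^* * t * b x y + (s^* * s * b x x + t^* * t * b y y) * ((Complex 0 1 : C) ^+ z)^* +
    (t^* * s * b y x) * ((Complex 0 1 : C) ^+ z)^* ^+ 2.
  by rewrite bE rmorphM /=; have zz := @ipow_conj R z; ring: zz.
rewrite (eq_bigr _ (fun z _ => sE z)) !big_split /= -!mulr_sumr.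
rewrite sum_ipow_conj sum_ipow_conj2 !mulr0 !addr0 sumr_const card_ord => /eqP.
by rewrite !mulf_eq0 conjC_eq0 (negbTE s0) (negbTE t0) mulrn_eq0 /= => /eqP.
Qed.

Definition cabs a : R := complex.Re `|a|.
Lemma cabsE a : `|a| = (cabs a)%:C.
Proof. by rewrite RRe_real ?normr_real. Qed.
Lemma cabs_ge0 a : 0 <= cabs a.
Proof. by rewrite -ler0c -cabsE. Qed.
Lemma cabsM a b : cabs (a * b) = cabs a * cabs b.
Proof. by apply: complexI; rewrite rmorphM /= -!cabsE normrM. Qed.
Lemma cabs_sum I (r : seq I) (P : pred I) (F : I -> C) :
  cabs (\sum_(i <- r | P i) F i) <= \sum_(i <- r | P i) cabs (F i).
Proof.
rewrite -lecR -cabsE; apply: le_trans (ler_norm_sum _ _ _) _.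
by rewrite rmorph_sum /=; apply: ler_sum => i _; rewrite cabsE.
Qed.
Lemma cabs_eq0 a : (cabs a == 0) = (a == 0).
Proof. by rewrite -(inj_eq (@complexI R)) -cabsE normr_eq0. Qed.
Lemma cabs_sqr a : cabs a ^+ 2 = sqC a.
Proof. by apply: complexI; rewrite rmorphXn /= -cabsE normC_sqr. Qed.

(* [phi] is summable, and [sum_k d n k * phi k = 0] expresses [phi n] by a tail
   carrying a factor [2^-(n+2)], so the [l^1] norm of [phi] is at most half of itself. *)
Lemma triangular_injective (d : nat -> nat -> C) (phi : nat -> C) (L : R) :
  (forall n k, (k < n)%N -> d n k = 0) -> (forall n, d n n = 1) ->
  (forall n k, (n < k)%N -> cabs (d n k) <= 2^-1 ^+ n.+2) ->
  (forall K, \sum_(k < K) cabs (phi k) <= L) ->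
  (forall n, (\sum_(k < K) d n k * phi k) @[K --> \oo] --> (0 : C^o)) ->
  forall n, phi n = 0.
Proof.
move=> d0 d1 dS phiL dphi.
have hS : has_sup (range (fun K => \sum_(k < K) cabs (phi k))).
  by split; [exists (\sum_(k < 0) cabs (phi k)); exists 0%N|exists L => _ [K _ <-]].
pose S := sup (range (fun K => \sum_(k < K) cabs (phi k))).
have leS K : \sum_(k < K) cabs (phi k) <= S.
  by apply: ub_le_sup; [case: hS|exists K].
have phin n : cabs (phi n) <= 2^-1 ^+ n.+2 * S.
  apply/ler_addgt0Pr => e e0.
  have /(@limP _ C^o)/(_ e e0)[N hN] := dphi n.
  have := hN (maxn N n.+1) (leq_maxl _ _); set K := maxn N n.+1.
  have nK : (n < K)%N by rewrite leq_maxr.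
  rewrite sub0r normrN cabsE lecR => le_e.
  have -> : phi n = \sum_(k < K) d n k * phi k -
      \sum_(k < K) (if k == n :> nat then 0 else d n k * phi k).
    rewrite -sumrB (bigD1 (Ordinal nK))//= eqxx subr0 d1 mul1r big1 ?addr0// => k kn.
    by rewrite (negbTE (kn : (nat_of_ord k != n))) subrr.
  have le_sub a b : cabs (a - b) <= cabs a + cabs b.
    rewrite -lecR rmorphD /= -!cabsE; exact: ler_normB.
  apply: le_trans (le_sub _ _) _; rewrite addrC; apply: lerD => //.
  apply: le_trans (cabs_sum _ _ _) _.
  apply: (@le_trans _ _ (\sum_(k < K) 2^-1 ^+ n.+2 * cabs (phi k))).
    apply: ler_sum => k _; have p0 : 0 <= 2^-1 ^+ n.+2 * cabs (phi k).
      by rewrite mulr_ge0 ?cabs_ge0// exprn_ge0// invr_ge0.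
    have c0 : cabs 0 = 0 by apply/eqP; rewrite cabs_eq0.
    case: (ltngtP k n) => [kn|nk|_]; rewrite ?c0// cabsM.
      by rewrite d0// c0 mul0r.
    by rewrite ler_wpM2r ?cabs_ge0// dS.
  by rewrite -mulr_sumr ler_wpM2l ?leS// exprn_ge0// invr_ge0.
have S0 : 0 <= S by apply: le_trans (leS 0%N); rewrite big_ord0.
have Sh : S <= S / 2.
  apply: ge_sup; first by case: hS.
  move=> _ [K _ <-]; apply: (@le_trans _ _ (\sum_(k < K) 2^-1 ^+ k.+2 * S)).
    by apply: ler_sum => k _; exact: phin.
  rewrite -mulr_suml mulrC ler_wpM2l//.
  have le2 : \sum_(l < K) 2^-1 ^+ l <= 2 * 2^-1 ^+ 0 :> R := geom_tail R 0 K.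
  have -> : \sum_(l < K) 2^-1 ^+ l.+2 = 4^-1 * \sum_(l < K) 2^-1 ^+ l :> R.
    by rewrite mulr_sumr; apply: eq_bigr => l _; rewrite !exprS; field.
  by move: le2; rewrite expr0; lra.
have S00 : S = 0 by lra.
move=> n; apply/eqP; rewrite -cabs_eq0 eq_le cabs_ge0 andbT.
by have := phin n; rewrite S00 mulr0.
Qed.

(** Because [A n] is diagonal in [f], the functional at [A n] is the sum of its entries against the
    diagonal [phi]. Bessel's inequality makes [phi] summable, so the triangular system applies. *)
Lemma diagonal_annihilator (A : nat -> H -> H) (f : nat -> H) p (c : 'I_p -> C)
    (u w : 'I_p -> H) : orthonormal_seq f ->
  (forall n, [/\ bounded_op (A n), self_adjoint (A n),
    forall j k, j != k -> '[A n (f j), f k] = 0,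
    forall k, (k < n)%N -> '[A n (f k), f k] = 0 & '[A n (f n), f n] = 1] /\
    forall k, (n < k)%N -> `|qform (A n) (f k)| <= 2^-1 ^+ n.+2) ->
  (forall i, proj f (u i) = u i) -> (forall i, proj f (w i) = w i) ->
  (forall n, \sum_i c i * '[A n (u i), w i] = 0) ->
  forall k, finite_rank_coef c u w (f k) (f k) = 0.
Proof.
move=> of_ AP fu fw Auw.
pose phi k := finite_rank_coef c u w (f k) (f k).
apply: (@triangular_injective (fun n k => '[A n (f k), f k]) phi
  (\sum_i cabs (c i) * (sqn (u i) + sqn (w i)))).
- by move=> n k; case: (AP n) => -[_ _ _ + _] _; apply.
- by move=> n; case: (AP n) => -[].
- move=> n k nk; case: (AP n) => -[_ sA _ _ _] /(_ k nk); rewrite qformE// /cabs.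
  by rewrite normc_def /= expr0n addr0 sqrtr_sqr.
- move=> K; apply: (@le_trans _ _ (\sum_(k < K) \sum_i
      cabs (c i) * (sqC '[u i, f k] + sqC '[w i, f k]))).
    apply: ler_sum => k _; apply: le_trans (cabs_sum _ _ _) _; apply: ler_sum => i _.
    rewrite !cabsM -mulrA ler_wpM2l ?cabs_ge0// -!cabs_sqr.
    have -> : cabs '[f k, w i] = cabs '[w i, f k].
      by rewrite /cabs ipC norm_conjC.
    by have := sqr_ge0 (cabs '[u i, f k] - cabs '[w i, f k]);
       have := sqr_ge0 (cabs '[u i, f k]); have := sqr_ge0 (cabs '[w i, f k]); nra.
  rewrite exchange_big; apply: ler_sum => i _ /=.
  rewrite -mulr_sumr ler_wpM2l ?cabs_ge0// big_split /=.
  by apply: lerD; exact: bessel.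
move=> n; have [[bA sA oA _ _] _] := AP n.
have AE j k : '[A n (f j), f k] = if j == k then '[A n (f j), f j] else 0.
  by case: eqVneq => [<-//|jk]; rewrite oA.
have limE : (fun K => \sum_i c i * '[psum f (fun k => '[u i, f k] * '[A n (f k), f k]) K, w i])
    K @[K --> \oo] --> (\sum_i c i * '[proj f (A n (proj f (u i))), w i] : C^o).
  apply: lim_lincomb => i; exact: lim_ipl (compression_diag of_ bA AE (u i)).
have e0 : \sum_i c i * '[proj f (A n (proj f (u i))), w i] = 0.
  rewrite -[RHS](Auw n); apply: eq_bigr => i _.
  by rewrite fu (proj_sa of_) fw.
rewrite e0 in limE; apply: (@eq_lim _ C^o _ _ _ _ limE) => K.
under [RHS]eq_bigr do rewrite /psum ip_suml mulr_sumr.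
rewrite [RHS]exchange_big /=; apply: eq_bigr => k _.
rewrite /phi /finite_rank_coef mulr_sumr; apply: eq_bigr => i _.
by rewrite ipZl; ring.
Qed.

(* Duality in finite dimension gives, for each finite list of pairs of vectors, an
   element of [V] with exactly the matrix coefficients of [T]; these elements form a
   net over finite lists converging weakly. *)
Lemma clique_of_interpolation (V : set (H -> H)) (g : nat -> H) : orthonormal_seq g ->
  V `<=` bounded_op -> V 0 ->
  (forall a A B, V A -> V B -> V (a *: A + B)) ->
  (forall p (c : 'I_p -> C) (u w : 'I_p -> H),
    (forall i, proj g (u i) = u i) -> (forall i, proj g (w i) = w i) ->
    (forall A, V A -> \sum_i c i * '[A (u i), w i] = 0) ->
    forall T, bounded_op T -> \sum_i c i * '[T (u i), w i] = 0) ->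
  infinite_quantum_clique V (proj g).
Proof.
move=> og bV V0 VD ann; split; [exact: projection_proj|exact: proj_infinite_rank|split].
  by move=> _ [A VA <-]; exists A => //; exact: bV.
move=> _ [T bT <-]; pose P := proj g.
have interp (l : seq (H * H)) : exists A, V A /\ forall q, q \in l ->
    '[P (A (P q.1)), q.2] = '[P (T (P q.1)), q.2].
  pose p := size l; pose u (i : 'I_p) := P (nth (0, 0) l i).1.
  pose w (i : 'I_p) := P (nth (0, 0) l i).2.
  pose row A : 'rV[C]_p := \row_i '[A (u i), w i].
  (* By separation it is enough that a column annihilating the coefficients of [V] annihilates those
     of [T], which is [ann]. *)
  have : [set row A | A in V] (row T).
    apply: subspace_separation.
    - by exists 0 => //; apply/rowP => i; rewrite !mxE ip0l.
    - move=> a _ _ [A VA <-] [B VB <-]; exists (a *: A + B); first exact: VD.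
      by apply/rowP => i; rewrite !mxE -ipZl -ipDl.
    - move=> c cV; have rowE A : row A *m c = (\sum_i c i 0 * '[A (u i), w i])%:M.
        rewrite [LHS]mx11_scalar !mxE; congr (_%:M); apply: eq_bigr => i _.
        by rewrite mxE mulrC.
      rewrite rowE (ann _ (fun i => c i 0)) ?raddf0//.
      - by move=> i; rewrite /u proj_proj.
      - by move=> i; rewrite /w proj_proj.
      move=> A VA; have := cV (row A) (ex_intro2 _ _ A VA erefl).
      by rewrite rowE => /matrixP/(_ 0 0); rewrite !mxE eqxx mulr1n.
  move=> [A VA rowA]; exists A; split=> // q ql.
  have lti : (index q l < p)%N by rewrite index_mem.
  have := congr1 (fun M : 'rV_p => M 0 (Ordinal lti)) rowA.
  by rewrite !mxE /u /w /= nth_index// !(proj_sa og).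
have /choice[A AP] := interp.
pose F : set_system (seq (H * H)) :=
  [set Q | exists l0 : seq (H * H), forall l : seq (H * H), {subset l0 <= l} -> Q l].
have FF : Filter F.
  split; first by exists [::].
    move=> Q1 Q2 [l1 h1] [l2 h2]; exists (l1 ++ l2) => l sl; split.
      by apply: h1 => q ql; apply: sl; rewrite mem_cat ql.
    by apply: h2 => q ql; apply: sl; rewrite mem_cat ql orbT.
  by move=> Q1 Q2 Q12 [l0 h]; exists l0 => l /h; exact: Q12.
pose W (l : seq (H * H)) : wot H := P \o A l \o P.
pose S : wot H := P \o T \o P.
have cW : W @ F --> S.
  apply: (proj2 (wot_cvgP W S FF)) => x y.
  apply: cvg_near_cst; exists [:: (x, y)] => l sl.
  by have [_ AE] := AP l; rewrite -[RHS](AE (x, y))//; apply: sl; rewrite inE.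
move=> N NS; have [l0 /(_ l0 (fun _ => id)) Nl] := cW N NS; exists (W l0); split=> //.
by exists (A l0) => //; case: (AP l0).
Qed.

Lemma infinite_case (V : set (H -> H)) : operator_system V ->
  ~ finite_dim [set: H] -> (forall n, ~ finite_compression V n) ->
  exists P, infinite_quantum_clique V P.
Proof.
move=> sysV infH infV.
have [A [f [of_ AP]]] := diagonalizing_sequence sysV infV (big_setT infH).
have [g [og fg frame]] := frame_sequence of_.
exists (proj g); apply: clique_of_interpolation => //; try by case: sysV.
  by case: (sa_part0 sysV).
have lP := proj_linear of_.
(* The range of [proj g] lies in that of [proj f], so a functional carried by the former can be
   expanded along [f]. *)
have fproj x : proj g x = x -> proj f x = x.
  move=> gx; rewrite -gx.
  apply: (lim_unique (lim_bounded_op (proj_bounded of_) (proj_cvg og x))).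
  apply: eq_lim (proj_cvg og x) => n; rewrite /psum (lin_sum _ _ _ lP).
  by apply: eq_bigr => k _; rewrite (linZ _ _ lP) fg.
move=> p c u w gu gw Vuw T bT.
have phi0 k : finite_rank_coef c u w (f k) (f k) = 0.
  move: k; apply: (@diagonal_annihilator A) => //.
  - move=> n; have [vA oA zA uA tA] := AP n; split=> //; split=> //.
      exact: (sa_part_bounded sysV vA).
    by case: vA.
  - by move=> i; exact: fproj.
  - by move=> i; exact: fproj.
  - by move=> n; apply: Vuw; case: (AP n) => -[].
apply: (finite_rank_annihilator og gu gw _ bT) => j l.
have [s [t [s0 t0 st]]] := frame j l.
apply: (coef_polarization s0 t0) => z; have [k <-] := st z.
(* As [proj g] fixes [u i] and [w i], the coefficient does not change when [f k] is replaced by its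
   projection. *)
rewrite -[RHS](phi0 k); apply: eq_bigr => i _.
by rewrite -(proj_sa og) gu (proj_sa og) gw.
Qed.

End Clique.

Theorem theorem1p3 (R : realType) (H : hilbertType R)
    (infinite_dimH : ~ finite_dim [set: H])
    (V : set (H -> H)) (systemV : operator_system V) :
  (exists P : H -> H, infinite_quantum_clique V P) \/
  (exists P : H -> H, infinite_quantum_anticlique V P) \/
  (exists P : H -> H, infinite_quantum_obstruction V P).
Proof.
have [[n finV]|infV] := pselect (exists n, finite_compression V n).
  by right; exact: (anticlique_or_obstruction systemV finV).
left; apply: infinite_case => // n finV; apply: infV.
by exists n.
Qed.
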